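(* For all real $\mu\ge0$ and all $x\in\mathbb{R}$, $x\neq0$, $$\int_0^1e^{xt}\left[t(1-t)\right]^{\mu-1/2}\ln\left[t(1-t)\right]dt=\mathrm{B}\left(\mu+\tfrac12,\mu+\tfrac12\right)\left(\frac{4}{|x|}\right)^{\mu}e^{x/2}\,\Gamma(1+\mu)\left\{I_\mu\left(\frac{|x|}{2}\right)\left[\psi\left(\mu+\tfrac12\right)-\ln|x|\right]+\frac{\partial I_\mu(|x|/2)}{\partial\mu}\right\}.$$
   Context: $\mathrm{B}(a,b)=\Gamma(a)\Gamma(b)/\Gamma(a+b)$ is the beta function, $\psi=\Gamma'/\Gamma$ the digamma function, $I_\mu$ the modified Bessel function of the first kind, and $\frac{\partial I_\mu(|x|/2)}{\partial\mu}$ is the derivative of $I_\mu$ with respect to its order at fixed argument $|x|/2$. *)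

(* Defs.v *)
From HB Require Import structures.
From mathcomp Require Import all_boot all_order all_algebra.
From mathcomp Require Import all_classical all_reals all_analysis.

Set Implicit Arguments.
Unset Strict Implicit.
Unset Printing Implicit Defensive.

Import Order.TTheory GRing.Theory Num.Theory.
Import numFieldNormedType.Exports.

Local Open Scope classical_set_scope.
Local Open Scope ring_scope.

Section special_functions.
Context {R : realType}.
Implicit Types (a b x z mu : R) (k : nat).

Definition euler_gamma x : R :=
  \int[@lebesgue_measure R]_(t in `]0, +oo[) (t `^ (x - 1) * expR (- t)).

(* Euler's integral on the positive reals, continued to the other reals by
   Gamma(x) = Gamma(x + n) / (x (x + 1) ... (x + n - 1)).  At the poles
   0, -1, -2, ... the product vanishes, so that gamma x = 0 = (gamma x)^-1;
   the latter is the value of the entire function 1 / Gamma. *)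
Definition gamma x : R :=
  if 0 < x then euler_gamma x
  else let n := (Num.truncn (- x)).+1 in
    euler_gamma (x + n%:R) / \prod_(i < n) (x + i%:R).

Definition digamma x : R := derive1 gamma x / gamma x.

Definition beta a b : R := gamma a * gamma b / gamma (a + b).

(* The power series at the origin; meant for z > 0 and any real order mu. *)
Definition besselI_term mu z k : R :=
  (z / 2) `^ (mu + (k.*2)%:R) / (k`!%:R * gamma (mu + k%:R + 1)).

Definition besselI mu z : R := limn (series (besselI_term mu z)).

Definition dbesselI_order mu z : R := derive1 (besselI ^~ z) mu.

End special_functions.

(* Main.v *)
Require Import Defs.
From HB Require Import structures.
From mathcomp Require Import all_boot all_order all_algebra.
From mathcomp Require Import all_classical all_reals all_analysis.
From mathcomp Require Import measurable_realfun ring lra.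
Import Order.TTheory GRing.Theory Num.Theory.
Import numFieldNormedType.Exports.
Local Open Scope classical_set_scope.
Local Open Scope ring_scope.

(* Write w = t (1 - t), and let F s be the integral of exp (x t) w^(s - 1/2) over ]0, 1[.
   Expanding exp (x (t - 1/2)) and computing the moments of t - 1/2 by parts gives
     F s = P s * I_s(|x| / 2),
     P s = B(s + 1/2, s + 1/2) (4 / |x|)^s e^(x / 2) Gamma(1 + s),
   once the integral K nu of w^(nu - 1) is known to be B(nu, nu). The left-hand side of the
   theorem is F' mu, by differentiation under the integral sign, so it remains to show
     P' / P = digamma(s + 1/2) - ln |x|,
   which follows from the duplication formula K(nu) Gamma(nu + 1/2) 4^nu = c Gamma(nu);
   differentiability of I_s in s comes from I_s = F s / P s.

   Both K(nu) = Gamma(nu)^2 / Gamma(2 nu) and the duplication formula are proved in the manner of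
   Bohr and Mollerup: the logarithm of the ratio of the two sides is 1-periodic by the functional
   equations, and constant because log-convexity makes the logarithm of each factor
   asymptotically affine on unit steps. *)

Set Implicit Arguments.
Unset Strict Implicit.
Unset Printing Implicit Defensive.

(** * Integration by exhaustion of an open set *)

Section exhaustion.
Context {R : realType}.
Notation mu := (@lebesgue_measure R).
Variables (D : set R) (oD : open D) (a b : R^nat).
Hypothesis ab : forall n, a n < b n.
Hypothesis abD : forall n, `[a n, b n] `<=` D.

Let mD : measurable D.
Proof. exact: open_measurable. Qed.

Lemma FTC2_open (h H : R -> R) n :
  {in D, continuous h} -> (forall t, D t -> is_derive t 1 H (h t)) ->
  (\int[mu]_(t in `[a n, b n]) (h t)%:E = (H (b n) - H (a n))%:E)%E.
Proof.
move=> ch dH.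
have cH t : D t -> {for t, continuous H}.
  move=> /dH dHt; apply: differentiable_continuous.
  by apply/derivable1_diffP; exact: (@ex_derive _ _ _ _ _ _ _ dHt).
have abd : `[a n, b n]%classic (a n) /\ `[a n, b n]%classic (b n).
  by rewrite /= !in_itv /= !lexx !(ltW (ab n)).
rewrite (continuous_FTC2 (f := h) (F := H)) ?EFinB //.
- apply: continuous_in_subspaceT => t tab; apply: ch.
  by apply/mem_set/(@abD n); exact: set_mem tab.
- split.
  + move=> t tab; have Dt : D t by apply: (@abD n); exact: subset_itv_oo_cc tab.
    by have := dH _ Dt => dHt; exact: (@ex_derive _ _ _ _ _ _ _ dHt).
  + apply: cvg_at_right_filter; apply: cH; apply: (@abD n); exact: abd.1.
  + apply: cvg_at_left_filter; apply: cH; apply: (@abD n); exact: abd.2.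
- move=> t tab; have Dt : D t by apply: (@abD n); exact: subset_itv_oo_cc tab.
  by rewrite derive1E; have := dH _ Dt => dHt; exact: derive_val.
Qed.

(** The integrals of [h] over the exhausting intervals are increments of [H], so monotone
    convergence bounds the integral of [h] over [D] by [M]. An improper integrand thus needs only a
    majorant with an explicit primitive of bounded increments. *)
Lemma integrable_le_primitive (f h H : R -> R) (M : R) :
  nondecreasing_seq (fun n => `[a n, b n]%classic) ->
  D `<=` \bigcup_n `[a n, b n]%classic ->
  measurable_fun D f -> (forall t, D t -> `|f t| <= h t) ->
  {in D, continuous h} -> (forall t, D t -> is_derive t 1 H (h t)) ->
  (forall n, H (b n) - H (a n) <= M) ->
  mu.-integrable D (EFin \o f).
Proof.
move=> ndE DE mf fh ch dH HM.
have h0 t : D t -> 0 <= h t by move=> Dt; exact: le_trans (normr_ge0 _) (fh _ Dt).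
have mh : measurable_fun D h by exact: open_continuous_measurable_fun.
apply: (@le_integrable _ _ _ mu D mD _ (EFin \o h)) => //.
- exact/measurable_EFinP.
- by move=> t Dt /=; rewrite lee_fin (le_trans (fh _ Dt))// ler_norm.
apply/integrableP; split; first exact/measurable_EFinP.
have DU : D = \bigcup_n `[a n, b n]%classic.
  by apply/seteqP; split => // t [n _ /abD].
under eq_integral => t /set_mem Dt do rewrite /= ger0_norm ?h0//.
have cv : ((\int[mu]_(t in `[a n, b n]) (h t)%:E) @[n --> \oo] -->
    \int[mu]_(t in D) (h t)%:E)%E.
  rewrite DU; apply: ge0_nondecreasing_set_cvg_integral => //.
  - by move=> n; apply/measurable_EFinP; exact: measurable_funS (@abD n) mh.
  - by move=> n t /abD Dt; rewrite lee_fin h0.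
apply: (@le_lt_trans _ _ M%:E); last exact: ltry.
apply: (cvge_le _ cv).
by near=> n; rewrite (FTC2_open _ ch dH) lee_fin.
Unshelve. all: by end_near. Qed.

(** Each point of [D] lies in all late intervals, so dominated convergence with majorant |h| makes
    the integral the limit of the increments of [H]. All integrations by parts below go through
    this. *)
Lemma Rintegral_primitive (h H : R -> R) (l : R) :
  (forall t, D t -> \forall n \near \oo, `[a n, b n]%classic t) ->
  mu.-integrable D (EFin \o h) ->
  {in D, continuous h} -> (forall t, D t -> is_derive t 1 H (h t)) ->
  H (b n) - H (a n) @[n --> \oo] --> l ->
  \int[mu]_(t in D) h t = l.
Proof.
move=> DE ih ch dH Hl.
have mh := measurable_int _ ih.
have ihE n : mu.-integrable D (EFin \o (h \_ `[a n, b n]%classic)).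
  apply: (@le_integrable _ _ _ mu D mD _ (EFin \o h)) => //.
  - rewrite -restrict_EFin; apply/(measurable_restrict _ _ mD) => //.
    exact: measurable_funS mh.
  - move=> t Dt; rewrite /= patchE; case: ifPn => // _.
    by rewrite normr0 lee_fin normr_ge0.
have cv : ((\int[mu]_(t in D) ((h \_ `[a n, b n]%classic) t)%:E) @[n --> \oo] -->
    \int[mu]_(t in D) (h t)%:E)%E.
  apply: (@dominated_cvg _ _ _ mu _ _ _ _ (fun t => `|(h t)%:E|)%E) => //.
  - by move=> n; exact: measurable_int (ihE n).
  - move=> t Dt; apply: cvg_near_cst; near=> n.
    rewrite patchE ifT//; apply/mem_set.
    by near: n; exact: DE.
  - exact: integrable_abse.
  - move=> n t Dt /=; rewrite patchE; case: ifPn => // _.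
    by rewrite normr0 lee_fin normr_ge0.
rewrite /Rintegral.
have -> : (\int[mu]_(t in D) (h t)%:E = l%:E)%E => //.
apply: cvg_unique cv _ => //.
have {}Hl : (H (b n) - H (a n))%:E @[n --> \oo] --> l%:E.
  by apply: cvg_EFin => //; exact: nearW.
apply: cvg_trans Hl.
apply: near_eq_cvg; near=> n => /=.
rewrite -(FTC2_open _ ch dH).
rewrite [RHS]integral_mkcond [LHS]integral_mkcond; apply: eq_integral => t _.
rewrite !patchE /=; case: ifPn => tE; case: ifPn => tD //.
by move: tE; rewrite notin_setE in tD; move/set_mem/abD.
Unshelve. all: by end_near. Qed.

End exhaustion.

(** * Parametric integrals of powers *)

Section power_kernel.
Context {R : realType}.
Notation mu := (@lebesgue_measure R).

Lemma powR_gt0E (u s : R) : 0 < u -> u `^ s = expR (s * ln u).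
Proof. by move=> u0; rewrite /powR gt_eqF. Qed.

(** For u <= 1, d |ln u| is at most u^(-d), and for u >= 1 at most u^d. The logarithm thus shifts
    the exponent by d, and s is itself within d of a; hence the exponents a - 2d and a + 2d. *)
Lemma powR_ln_le (u s a d : R) : 0 < u -> 0 < d -> a - d <= s <= a + d ->
  u `^ s * `|ln u| <= (u `^ (a - d *+ 2) + u `^ (a + d *+ 2)) / d.
Proof.
move=> u0 d0 /andP[s1 s2]; rewrite ler_pdivlMr// -mulrA.
case: (leP u 1) => [u1|/ltW u1].
  rewrite ler0_norm ?ln_le0//.
  have h : - ln u * d <= u `^ (- d).
    have := ln_sublinear (powR_gt0 (- d) u0); rewrite ln_powR => /ltW.
    by rewrite mulNr mulNr mulrC.
  apply: (le_trans (ler_wpM2l (powR_ge0 _ _) h)).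
  rewrite -powRD; last by rewrite (gt_eqF u0) implybT.
  apply: (@le_trans _ _ (u `^ (a - d *+ 2))); last by rewrite lerDl powR_ge0.
  by apply: ger_powR; [rewrite u0|lra].
rewrite ger0_norm ?ln_ge0//.
have h : ln u * d <= u `^ d.
  have := ln_sublinear (powR_gt0 d u0); rewrite ln_powR => /ltW.
  by rewrite mulrC.
apply: (le_trans (ler_wpM2l (powR_ge0 _ _) h)).
rewrite -powRD; last by rewrite (gt_eqF u0) implybT.
apply: (@le_trans _ _ (u `^ (a + d *+ 2))); last by rewrite lerDr powR_ge0.
by apply: ler_powR => //; lra.
Qed.

Lemma is_derive_powRr (u c s : R) : 0 < u ->
  is_derive s 1 (fun s => u `^ (s - c)) (u `^ (s - c) * ln u).
Proof.
move=> u0; rewrite (_ : (fun s => _) = (fun s => expR ((s - c) * ln u))); last first.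
  by apply/funext => r; rewrite powR_gt0E.
rewrite powR_gt0E//; apply: is_derive_eq.
by rewrite /GRing.scale /=; ring.
Qed.

Variables (D : set R) (mD : measurable D) (v w : R -> R) (a c d : R).
Hypotheses (mv : measurable_fun D v) (mw : measurable_fun D w).
Hypothesis w0 : forall t, D t -> 0 < w t.
Hypothesis d0 : 0 < d.
Hypothesis ivw : forall s : R, a - d *+ 2 <= s <= a + d *+ 2 ->
  mu.-integrable D (EFin \o (fun t => v t * w t `^ (s - c))).

(** Majorant of the differentiated integrand, uniform for s within d of a. It uses the extreme
    exponents of the range of radius 2d on which integrability is assumed. *)
Let G (t : R) : R := `|v t| * ((w t `^ (a - c - d *+ 2) + w t `^ (a - c + d *+ 2)) / d).

Let mG s : measurable_fun D (fun t => v t * w t `^ (s - c) * ln (w t)).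
Proof.
apply: measurable_funM; first apply: measurable_funM => //.
- by apply: (measurableT_comp (measurable_powR _)).
- by apply: (measurableT_comp (@measurable_ln R)).
Qed.

Let G_ub (s t : R) : a - d <= s <= a + d -> D t ->
  `|v t * w t `^ (s - c) * ln (w t)| <= G t.
Proof.
move=> sa Dt; rewrite -mulrA normrM /G ler_wpM2l//.
rewrite normrM [`|_ `^ _|]ger0_norm ?powR_ge0//.
by apply: powR_ln_le; [exact: w0|by []|lra].
Qed.

Let iG : mu.-integrable D (EFin \o G).
Proof.
have -> : EFin \o G = (fun t => d^-1%:E * (`|(v t * w t `^ (a - d *+ 2 - c))%:E| +
   `|(v t * w t `^ (a + d *+ 2 - c))%:E|))%E.
  apply/funext => t /=; rewrite -EFinD -EFinM; congr EFin.
  rewrite !normrM ![`|_ `^ _|]ger0_norm ?powR_ge0// /G.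
  by rewrite (addrAC a) (addrAC a (d *+ 2)); ring.
apply: integrableZl => //; apply: integrableD => //; apply: integrable_abse; apply: ivw;
  have := d0; lra.
Qed.

Lemma integrable_powR_ln :
  mu.-integrable D (EFin \o (fun t => v t * w t `^ (a - c) * ln (w t))).
Proof.
apply: (@le_integrable _ _ _ mu D mD _ (EFin \o G)) => //.
- by apply/measurable_EFinP; exact: (mG a).
- move=> t Dt /=; rewrite lee_fin (le_trans _ (ler_norm _))// G_ub//.
  by have := d0; lra.
Qed.

Lemma is_derive_powR_integral :
  is_derive a 1 (fun s => \int[mu]_(t in D) (v t * w t `^ (s - c)))
    (\int[mu]_(t in D) (v t * w t `^ (a - c) * ln (w t))).
Proof.
pose f (s t : R) : R := v t * w t `^ (s - c).
have df (s t : R) : D t -> is_derive s 1 (f ^~ t) (v t * w t `^ (s - c) * ln (w t)).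
  move=> Dt; have := is_derive_powRr c s (w0 Dt) => ?.
  by rewrite /f; apply: is_derive_eq; rewrite /GRing.scale /= mulrA.
have d1f (s t : R) : D t -> partial1of2 f s t = v t * w t `^ (s - c) * ln (w t).
  move=> Dt; rewrite partial1of2E; have := df s _ Dt => dfs; exact: derive_val.
have Ia : `]a - d, a + d[%classic a by rewrite /= in_itv /=; have := d0; lra.
have sub (s : R) : `]a - d, a + d[%classic s -> a - d <= s <= a + d.
  by rewrite /= in_itv /=; have := d0; lra.
have intf (s : R) : `]a - d, a + d[%classic s -> mu.-integrable D (EFin \o f s).
  by move=> /sub sa; apply: ivw; have := d0; lra.
have derf (s t : R) : `]a - d, a + d[%classic s -> D t -> derivable (f ^~ t) s 1.
  by move=> _ Dt; have := df s _ Dt => dfs; exact: ex_derive.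
have G0 (t : R) : 0 <= G t.
  by rewrite /G mulr_ge0// divr_ge0 ?addr_ge0 ?powR_ge0//; exact: ltW.
have Gub (s t : R) : `]a - d, a + d[%classic s -> D t -> `|partial1of2 f s t| <= G t.
  by move=> /sub sa Dt; rewrite d1f// G_ub.
apply: DeriveDef.
  exact: (@derivable_under_integral R _ _ mu f D mD a _ _ Ia intf derf G G0 iG Gub).
rewrite -derive1E.
rewrite [LHS](@differentiation_under_integral R _ _ mu f D mD a _ _ Ia intf derf G G0 iG Gub).
by apply: eq_Rintegral => t /set_mem Dt; rewrite -(d1f a).
Qed.

End power_kernel.

(** * Log-convexity *)

Section log_convexity.
Context {R : realType}.
Notation mu := (@lebesgue_measure R).

(** A zero integral would force f = 0 almost everywhere on [D]; since f has no zero there, [D] would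
    be negligible. *)
Lemma Rintegral_gt0 d (T : measurableType d) (nu : {measure set T -> \bar R})
    (D : set T) (f : T -> R) : measurable D -> (0 < nu D)%E ->
  nu.-integrable D (EFin \o f) -> (forall t, D t -> 0 < f t) ->
  0 < \int[nu]_(t in D) f t.
Proof.
move=> mD D0 fi f0; rewrite lt_neqAle Rintegral_ge0 ?andbT; last by move=> t /f0/ltW.
apply/negP => /eqP/esym f_0.
have fE : (\int[nu]_(t in D) `|(f t)%:E| = 0)%E.
  under eq_integral => t /set_mem Dt do rewrite gee0_abs ?lee_fin ?(ltW (f0 _ Dt))//.
  by rewrite -(fineK (integrable_fin_num mD fi)) -[X in X%:E]/(\int[nu]_(t in D) f t) f_0.
have /ae_eq_integral_abs : measurable_fun D (EFin \o f) by exact: measurable_int fi.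
move=> /(_ nu mD) [/(_ fE) [N [mN N0 DN]] _].
suff : (nu D <= 0)%E by rewrite leNgt D0.
rewrite -N0; apply: le_measure; rewrite ?inE// => t Dt; apply: DN => /= /(_ Dt) [].
by move/eqP; rewrite (gt_eqF (f0 _ Dt)).
Qed.

Lemma integrable_EFinZl d (T : measurableType d) (nu : {measure set T -> \bar R})
    (D : set T) (k : R) (f : T -> R) : measurable D ->
  nu.-integrable D (EFin \o f) -> nu.-integrable D (EFin \o (fun t => k * f t)).
Proof. by move=> mD fi; rewrite (_ : EFin \o _ = fun t => k%:E * (f t)%:E)%E //;
  exact: integrableZl. Qed.

Lemma integrable_EFinD d (T : measurableType d) (nu : {measure set T -> \bar R})
    (D : set T) (f g : T -> R) : measurable D -> nu.-integrable D (EFin \o f) ->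
  nu.-integrable D (EFin \o g) -> nu.-integrable D (EFin \o (fun t => f t + g t)).
Proof. by move=> mD fi gi; rewrite (_ : EFin \o _ = fun t => (f t)%:E + (g t)%:E)%E //;
  exact: integrableD. Qed.

Lemma integrable_EFinB d (T : measurableType d) (nu : {measure set T -> \bar R})
    (D : set T) (f g : T -> R) : measurable D -> nu.-integrable D (EFin \o f) ->
  nu.-integrable D (EFin \o g) -> nu.-integrable D (EFin \o (fun t => f t - g t)).
Proof.
by move=> mD fi gi; rewrite (_ : EFin \o _ = fun t => (f t)%:E - (g t)%:E)%E //;
  exact: integrableB.
Qed.

(** Weigh the tangent bounds of exp at (1 - s) l and at - s l by s and 1 - s: the linear terms
    cancel. Multiplying by exp (s l) gives the chord. *)
Lemma expR_le_chord (l s : R) : 0 <= s <= 1 ->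
  expR (s * l) <= 1 - s + s * expR l.
Proof.
move=> /andP[s0 s1].
have h1 := expR_ge1Dx ((1 - s) * l).
have h2 := expR_ge1Dx (- (s * l)).
have h : 1 <= s * expR ((1 - s) * l) + (1 - s) * expR (- (s * l)).
  have := ler_wpM2l s0 h1; have : 0 <= 1 - s by rewrite subr_ge0.
  by move=> /ler_wpM2l/(_ _ _ h2); lra.
have := ler_wpM2l (expR_ge0 (s * l)) h.
rewrite mulr1 mulrDr !(mulrCA (expR (s * l))) -!expRD subrr expR0 mulr1.
rewrite (_ : s * l + (1 - s) * l = l); last by ring.
by rewrite addrC.
Qed.

(** Log-convexity in the exponent, that is, Hölder's inequality, obtained by integrating the
    pointwise bound [expR_le_chord] at ln (w t) - l. *)
Lemma Rintegral_powR_le (D : set R) (v w : R -> R) (c x s : R) :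
  measurable D -> (0 < mu D)%E ->
  (forall t, D t -> 0 < v t) -> (forall t, D t -> 0 < w t) -> 0 <= s <= 1 ->
  let L r := \int[mu]_(t in D) (v t * w t `^ (r - c)) in
  (forall r, x <= r <= x + 1 ->
     mu.-integrable D (EFin \o (fun t => v t * w t `^ (r - c)))) ->
  ln (L (x + s)) <= ln (L x) + s * (ln (L (x + 1)) - ln (L x)).
Proof.
move=> mD D0 v0 w0 s01 L iL.
have [s0 s1] := andP s01.
have x0 : x <= x <= x + 1 by lra.
have x1 : x <= x + 1 <= x + 1 by lra.
have xs : x <= x + s <= x + 1 by lra.
have Lgt0 r : x <= r <= x + 1 -> 0 < L r.
  move=> xr; apply: Rintegral_gt0 => //; first exact: iL.
  by move=> t Dt; rewrite mulr_gt0 ?v0 ?powR_gt0 ?w0.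
(* With this choice exp (- l) L (x + 1) = L x, so the convex combination below collapses to L x and
   the bound becomes exp (s l) L x. *)
pose l := ln (L (x + 1)) - ln (L x).
have le1 : L (x + s) <= expR (s * l) * ((1 - s) * L x + s * expR (- l) * L (x + 1)).
  have i0 : mu.-integrable D (EFin \o (fun t => (1 - s) * (v t * w t `^ (x - c)))).
    by apply: integrable_EFinZl => //; exact: iL.
  have i1 : mu.-integrable D
      (EFin \o (fun t => s * expR (- l) * (v t * w t `^ (x + 1 - c)))).
    by apply: integrable_EFinZl => //; exact: iL.
  rewrite -!RintegralZl//; try exact: iL.
  rewrite -RintegralD// -RintegralZl//; last exact: integrable_EFinD.
  apply: le_Rintegral => //; first exact: iL.
    by apply: integrable_EFinZl => //; exact: integrable_EFinD.
  move=> t Dt; have wt := w0 _ Dt.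
  rewrite !powR_gt0E//.
  have := expR_le_chord (ln (w t) - l) s01.
  move=> /(ler_wpM2l (expR_ge0 (s * l))).
  have vw : 0 <= v t * expR ((x - c) * ln (w t)).
    by rewrite mulr_ge0 ?expR_ge0 // ltW// v0.
  move=> /(ler_wpM2l vw).
  rewrite -expRD -[leLHS]mulrA -expRD.
  rewrite (_ : (x - c) * ln (w t) + _ = (x + s - c) * ln (w t)); last by ring.
  move=> /le_trans; apply.
  rewrite (_ : (x + 1 - c) * ln (w t) = (x - c) * ln (w t) + ln (w t)); last by ring.
  rewrite !expRD le_eqVlt; apply/orP; left; apply/eqP; ring.
have Lx := Lgt0 _ x0; have Lx1 := Lgt0 _ x1.
have El : expR (- l) * L (x + 1) = L x.
  rewrite /l; move: (L x) (L (x + 1)) Lx Lx1 => A B A0 B0.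
  by rewrite opprB expRD expRN !lnK ?posrE// mulfVK// gt_eqF.
rewrite -mulrA El -mulrDl subrK mul1r in le1.
have Lxs := Lgt0 _ xs; rewrite -/l; move: l {El} le1 => l.
move: (L x) (L (x + s)) Lx Lxs => A B A0 B0 le1.
by rewrite -ler_expR expRD !lnK ?posrE// mulrC.
Qed.

End log_convexity.

(** * Functions asymptotically affine on unit steps *)

Section unit_steps.
Context {R : realType}.
Implicit Types (phi psi : R -> R) (x s : R).

(** The deviation of [phi] from its chord on a unit interval far to the right. Unlike convexity, its
    vanishing is preserved by differences, hence passes to the logarithm of a quotient. *)
Definition asym_affine phi := forall x s, 0 < x -> 0 <= s <= 1 ->
  phi (x + n%:R + s) - phi (x + n%:R) - s * (phi (x + n%:R + 1) - phi (x + n%:R))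
    @[n --> \oo] --> 0.

Lemma asym_affineD phi psi : asym_affine phi -> asym_affine psi ->
  asym_affine (fun x => phi x + psi x).
Proof.
move=> hphi hpsi x s x0 s01.
have := cvgD (hphi x s x0 s01) (hpsi x s x0 s01); rewrite addr0 => h.
by apply: (cvg_trans _ (h _)); apply: near_eq_cvg; apply: nearW => n /=; rewrite !fctE; ring.
Qed.

Lemma asym_affineZ (k : R) phi : asym_affine phi -> asym_affine (fun x => k * phi x).
Proof.
move=> hphi x s x0 s01.
rewrite -(mulr0 k).
under eq_fun do rewrite -!mulrBr mulrCA -mulrBr.
by apply: cvgM; [exact: cvg_cst|exact: hphi].
Qed.

Lemma asym_affine_linear (k : R) : asym_affine (fun x => x * k).
Proof.
move=> x s x0 s01; apply: cvg_near_cst; apply: nearW => n; ring.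
Qed.

(* Convexity squeezes [phi (x + s) - phi x] between
   [s * D x - (1 - s) * (D (x + s) - D x)] and [s * D x], where [D x = phi (x + 1) - phi x]. *)
Lemma asym_affine_convex phi :
  (forall x s, 0 < x -> 0 <= s <= 1 ->
     phi (x + s) <= phi x + s * (phi (x + 1) - phi x)) ->
  (forall x s, 0 < x -> 0 <= s <= 1 ->
     (phi (x + n%:R + s + 1) - phi (x + n%:R + s)) - (phi (x + n%:R + 1) - phi (x + n%:R))
       @[n --> \oo] --> 0) ->
  asym_affine phi.
Proof.
move=> cphi dphi x s x0 s01; have [s0 s1] := andP s01.
pose D y := phi (y + 1) - phi y.
have xn n : 0 < x + n%:R by rewrite ltr_wpDr.
have lo : - ((1 - s) * (D (x + n%:R + s) - D (x + n%:R))) @[n --> \oo] --> 0.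
  rewrite -oppr0; apply: cvgN; rewrite -(mulr0 (1 - s)); apply: cvgM; first exact: cvg_cst.
  exact: dphi.
apply: (squeeze_cvgr _ lo (cvg_cst 0)); apply: nearW => n.
have h1 := cphi _ _ (xn n) s01.
(* Convexity once more, on the unit interval starting at x + n + s: the fraction 1 - s of it ends at
   x + n + 1, which gives the lower bound. *)
have s01' : 0 <= 1 - s <= 1 by lra.
have h2 : phi (x + n%:R + 1) <=
    phi (x + n%:R + s) + (1 - s) * (phi (x + n%:R + s + 1) - phi (x + n%:R + s)).
  have := cphi (x + n%:R + s) _ _ s01'.
  by rewrite (_ : x + n%:R + s + (1 - s) = x + n%:R + 1); [apply; rewrite ltr_wpDr|ring].
rewrite /D; apply/andP; split; lra.
Qed.

(** Periodicity makes the sequence in [asym_affine] constant, equal to phi (x + s) - phi x, so its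
    limit 0 is its value. *)
Lemma periodic_asym_affine_cst phi : asym_affine phi ->
  (forall x, 0 < x -> phi (x + 1) = phi x) -> forall x, 0 < x -> phi x = phi 1.
Proof.
move=> hphi p1.
have pn n x : 0 < x -> phi (x + n%:R) = phi x.
  move=> x0; elim: n => [|n ih]; first by rewrite addr0.
  by rewrite -natr1 addrA p1 ?ltr_wpDr.
have h x s : 0 < x -> 0 <= s <= 1 -> phi (x + s) = phi x.
  move=> x0 s01; have [s0 _] := andP s01.
  have /cvg_lim := hphi x s x0 s01 => /(_ (@Rhausdorff R)).
  rewrite (_ : (fun n => _) = cst (phi (x + s) - phi x)) ?lim_cst//; first lra.
  apply/funext => n /=.
  by rewrite p1 ?ltr_wpDr// pn// (addrAC x) pn ?ltr_wpDr// subrr mulr0 subr0.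
(* Moving to x + 1 makes the integer part at least 1, so that [h] applies at a positive integer with
   s the fractional part. *)
move=> x x0; rewrite -p1//; have x1 : 0 <= x + 1 by lra.
have /andP[tx xt] := truncn_itv x1.
have t1 : (1 <= Num.truncn (x + 1))%N by rewrite truncn_ge_nat// lerDr ltW.
rewrite (_ : x + 1 = (Num.truncn (x + 1))%:R + (x + 1 - (Num.truncn (x + 1))%:R)); last by ring.
rewrite h; first last.
- by rewrite subr_ge0 tx/= lerBlDl natr1 ltW.
- by rewrite ltr0n.
by case: (Num.truncn _) t1 => // n _; rewrite -natr1 addrC pn.
Qed.

(** The factor k cancels, and what is left is ln (1 + s / (x + n)), squeezed between 0 and s / (x +
    n). *)
Lemma lnD_sub_cvg0 (k x s : R) : 0 < k -> 0 < x -> 0 <= s ->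
  ln (k * (x + n%:R + s)) - ln (k * (x + n%:R)) @[n --> \oo] --> 0.
Proof.
move=> k0 x0 s0.
have xn n : 0 < x + n%:R by rewrite ltr_wpDr.
have up : s / (x + n%:R) @[n --> \oo] --> 0.
  rewrite -(mulr0 s); apply: cvgM; first exact: cvg_cst.
  apply/gtr0_cvgV0; first exact: nearW.
  apply/cvgryPge => A; near=> n.
  apply: (@le_trans _ _ n%:R); last by rewrite lerDr ltW.
  by near: n; exact: nbhs_infty_ger.
apply: (squeeze_cvgr _ (cvg_cst 0) up); apply: nearW => n /=.
have xns : 0 < x + n%:R + s by rewrite ltr_wpDr.
rewrite !lnM ?posrE// opprD addrACA subrr add0r subr_ge0.
rewrite ler_ln ?posrE// lerDl s0 /= -ln_div ?posrE// mulrDl divff ?gt_eqF//.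
by apply: le_ln1Dx; apply: (@lt_le_trans _ _ 0); rewrite ?ltrN10// divr_ge0// ltW.
Unshelve. all: by end_near. Qed.


End unit_steps.

(** * The kernel t (1 - t) *)

Section bump.
Context {R : realType}.
Notation mu := (@lebesgue_measure R).
Notation U01 := (`]0%R, 1%R[%classic : set R).

Lemma open_U01 : open U01.
Proof. exact: interval_open. Qed.

Definition bump (t : R) : R := t * (1 - t).

Lemma bump_gt0 (t : R) : U01 t -> 0 < bump t.
Proof. by rewrite /= in_itv /= => /andP[t0 t1]; rewrite mulr_gt0 ?subr_gt0. Qed.

Lemma bump_le1 (t : R) : U01 t -> bump t <= 1.
Proof.
rewrite /= in_itv /= => /andP[t0 t1]; rewrite /bump -[leRHS]mulr1.
by apply: ler_pM; rewrite ?subr_ge0 ?lerBlDr ?lerDl; exact: ltW.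
Qed.

Lemma measurable_bump D : measurable_fun D bump.
Proof.
apply: measurable_funTS; apply: continuous_measurable_fun => t.
by apply: cvgM; [exact: cvg_id|apply: cvgB; [exact: cvg_cst|exact: cvg_id]].
Qed.

Lemma is_derive_bump_powR (nu t : R) : U01 t ->
  is_derive t 1 (fun t => bump t `^ nu) (nu * (1 - t *+ 2) * bump t `^ (nu - 1)).
Proof.
move=> Ut; have w0 := bump_gt0 Ut.
have d1 : is_derive t 1 bump (1 - t *+ 2).
  by rewrite /bump; apply: is_derive_eq; rewrite /GRing.scale /=; ring.
have d2 : is_derive (bump t) 1 (@powR R ^~ nu) (nu * bump t `^ (nu - 1)).
  apply: DeriveDef; first by apply: derivable_powR; rewrite in_itv /= andbT.
  by rewrite -derive1E powR_derive1// in_itv /= andbT.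
have := is_derive1_comp d2 d1.
by rewrite mulrAC; apply.
Qed.

Lemma continuous_bump_powR (nu t : R) : U01 t -> {for t, continuous (fun t => bump t `^ nu)}.
Proof.
move=> /(is_derive_bump_powR nu) dt; apply: differentiable_continuous.
by apply/derivable1_diffP; exact: ex_derive.
Qed.

(** The index starts at 3 so that the interval from [bump_lo n] to 1 - [bump_lo n] is nondegenerate
    already for n = 0. *)
Definition bump_lo (n : nat) : R := n.+3%:R^-1.
Definition bump_hi (n : nat) : R := 1 - bump_lo n.

Lemma bump_lo_itv n : 0 < bump_lo n <= 3^-1.
Proof. by rewrite /bump_lo invr_gt0 ltr0n /= lef_pV2 ?posrE ?ltr0n// ler_nat. Qed.

Lemma bump_lo_hi n : bump_lo n < bump_hi n.
Proof. by have := bump_lo_itv n; rewrite /bump_hi; lra. Qed.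

Lemma bump_lo_cvg0 : bump_lo n @[n --> \oo] --> 0.
Proof.
apply/gtr0_cvgV0; first by apply: nearW => n; rewrite ltr0n.
apply/cvgryPge => A; near=> n.
apply: (@le_trans _ _ n%:R); last by rewrite ler_nat -addn3 leq_addr.
by near: n; exact: nbhs_infty_ger.
Unshelve. all: by end_near. Qed.

Lemma bump_itv_sub n : `[bump_lo n, bump_hi n] `<=` U01.
Proof.
move=> t; have := bump_lo_itv n; rewrite /= !in_itv /= /bump_hi.
by move=> /andP[? ?] /andP[? ?]; apply/andP; split; lra.
Qed.

Lemma bump_itv_nd : nondecreasing_seq (fun n => `[bump_lo n, bump_hi n]%classic).
Proof.
apply/nondecreasing_seqP => n; apply/subsetPset => t; rewrite /= !in_itv /= /bump_hi.
have : bump_lo n.+1 <= bump_lo n by rewrite lef_pV2 ?posrE ?ltr0n// ler_nat.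
by move=> ? /andP[? ?]; apply/andP; split; lra.
Qed.

Lemma bump_itv_near (t : R) : U01 t -> \forall n \near \oo, `[bump_lo n, bump_hi n]%classic t.
Proof.
rewrite /= in_itv /= => /andP[t0 t1].
have m0 : 0 < Num.min t (1 - t) by rewrite lt_min t0 subr_gt0.
near=> n.
have : bump_lo n <= Num.min t (1 - t).
  near: n; have := cvgr_le 0 bump_lo_cvg0; exact.
rewrite le_min => /andP[h1 h2].
by rewrite /= in_itv /= h1 /bump_hi; lra.
Unshelve. all: by end_near. Qed.

Lemma bump_itv_cover : U01 `<=` \bigcup_n `[bump_lo n, bump_hi n]%classic.
Proof. by move=> t /bump_itv_near[n _ /(_ n (leqnn n))]; exists n. Qed.

Lemma bump_powR_hi (nu : R) n : bump (bump_hi n) `^ nu = bump (bump_lo n) `^ nu.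
Proof. by rewrite /bump /bump_hi; congr (_ `^ _); ring. Qed.

Lemma bump_powR_lo_cvg0 (nu : R) : 0 < nu -> bump (bump_lo n) `^ nu @[n --> \oo] --> 0.
Proof.
move=> nu0.
have up : bump_lo n `^ nu @[n --> \oo] --> 0.
  have /cvg_at_rightP := powR_cvg0 nu0; apply; split; last exact: bump_lo_cvg0.
  by move=> n; have /andP[] := bump_lo_itv n.
apply: (squeeze_cvgr _ (cvg_cst 0) up); apply: nearW => n.
have /andP[l0 l1] := bump_lo_itv n.
have b1 : 0 < bump (bump_lo n) <= bump_lo n.
  rewrite /bump ler_piMr ?mulr_gt0 ?subr_gt0// ?lerBlDr ?lerDl ?ltW//; lra.
rewrite powR_ge0 ge0_ler_powR ?nnegrE//; lra.
Qed.

Lemma integrable_bump_powR (nu : R) : 0 < nu ->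
  mu.-integrable U01 (EFin \o (fun t => bump t `^ (nu - 1))).
Proof.
move=> nu0.
(* Since (t - 1/2)^2 = 1/4 - w with w = [bump t], the derivative of (t - 1/2) w^nu is (1 + 2 nu)
   w^nu - (nu / 2) w^(nu - 1). Multiplying by - c normalises the singular term, and the linear term
   of [H] makes the remainder nonnegative because w^nu <= 1. *)
pose c : R := 2 / nu; have c0 : 0 < c by rewrite divr_gt0.
pose H (t : R) := c * ((1 + nu *+ 2) * t - (t - 2^-1) * bump t `^ nu).
pose h (t : R) := bump t `^ (nu - 1) + c * (1 + nu *+ 2) * (1 - bump t `^ nu).
have bS t : U01 t -> bump t `^ nu = bump t * bump t `^ (nu - 1).
  by move=> Ut; rewrite mulr_powRB1// ltW// bump_gt0.
have b1 t : U01 t -> bump t `^ nu <= 1.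
  move=> Ut; rewrite -(powRr0 (bump t)); apply: ger_powR; last exact: ltW.
  by rewrite bump_gt0//= bump_le1.
apply: (integrable_le_primitive open_U01 bump_lo_hi (@bump_itv_sub) (h := h) (H := H)
  (M := c * (1 + nu *+ 2 + 1)) bump_itv_nd bump_itv_cover).
- by apply: (measurableT_comp (measurable_powR _)); exact: measurable_bump.
- move=> t Ut; rewrite ger0_norm ?powR_ge0// lerDl mulr_ge0 ?subr_ge0 ?b1//.
  by rewrite mulr_ge0; lra.
- move=> t /set_mem Ut; apply: cvgD; first exact: continuous_bump_powR.
  apply: cvgM; first exact: cvg_cst.
  by apply: cvgB; [exact: cvg_cst|exact: continuous_bump_powR].
- move=> t Ut; have d := is_derive_bump_powR nu Ut.
  rewrite /H; apply: is_derive_eq; rewrite /GRing.scale /= /h bS// /bump /c.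
  by field; rewrite gt_eqF.
- move=> n; have /andP[l0 l1] := bump_lo_itv n; rewrite /H bump_powR_hi -mulrBr.
  have Ulo : U01 (bump_lo n) by rewrite /= in_itv /= l0; lra.
  have p0 := powR_ge0 (bump (bump_lo n)) nu; have := b1 _ Ulo => p1.
  rewrite ler_wpM2l ?(ltW c0)// /bump_hi; nra.
Qed.

End bump.

(** * Centred moments of powers of the kernel *)

Section bump_moments.
Context {R : realType}.
Notation mu := (@lebesgue_measure R).
Notation U01 := (`]0%R, 1%R[%classic : set R).
Implicit Types (nu t : R) (m : nat).

Lemma integrable_bumpM (v : R -> R) (C nu : R) : 0 < nu ->
  measurable_fun U01 v -> (forall t, U01 t -> `|v t| <= C) ->
  mu.-integrable U01 (EFin \o (fun t => v t * bump t `^ (nu - 1))).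
Proof.
move=> nu0 mv vC.
apply: (@le_integrable _ _ _ mu U01 _ _ (EFin \o (fun t => C * bump t `^ (nu - 1)))) => //.
- apply/measurable_EFinP; apply: measurable_funM => //.
  by apply: (measurableT_comp (measurable_powR _)); exact: measurable_bump.
- move=> t Ut; rewrite /= lee_fin !normrM ler_wpM2r//.
  by rewrite (le_trans (vC _ Ut))// ler_norm.
- by apply: integrable_EFinZl => //; exact: integrable_bump_powR.
Qed.

(** Centring at the symmetry point 1/2 makes the odd moments vanish and, through (t - 1/2)^2 = 1/4 -
    [bump t], gives a two-step recurrence. *)
Definition bump_moment nu m : R :=
  \int[mu]_(t in U01) ((t - 2^-1) ^+ m * bump t `^ (nu - 1)).

Lemma norm_centered_le1 t m : U01 t -> `|(t - 2^-1) ^+ m| <= 1.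
Proof.
rewrite /= in_itv /= => /andP[t0 t1]; rewrite normrX exprn_ile1// ler_norml.
by apply/andP; split; lra.
Qed.

Lemma measurable_centered D m : measurable_fun D (fun t : R => (t - 2^-1) ^+ m).
Proof. by apply: measurable_funX; apply: measurable_funB. Qed.

Lemma integrable_bump_moment nu m : 0 < nu ->
  mu.-integrable U01 (EFin \o (fun t => (t - 2^-1) ^+ m * bump t `^ (nu - 1))).
Proof.
move=> nu0; apply: (@integrable_bumpM _ 1) => //; first exact: measurable_centered.
by move=> t; exact: norm_centered_le1.
Qed.

Lemma is_derive_centeredX t m :
  is_derive t 1 (fun t : R => (t - 2^-1) ^+ m) (m%:R * (t - 2^-1) ^+ m.-1).
Proof.
have d : is_derive t 1 (fun t : R => t - 2^-1) 1.
  by apply: is_derive_eq; rewrite scaler0 oppr0 addr0.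
rewrite -(_ : (fun t : R => t - 2^-1) ^+ m = fun t => (t - 2^-1) ^+ m); last first.
  by rewrite exprfctE.
by apply: (is_derive_eq (is_deriveX m d)); rewrite /GRing.scale /= mulr1.
Qed.

Lemma continuous_centeredX t m : {for t, continuous (fun t : R => (t - 2^-1) ^+ m)}.
Proof.
have d := is_derive_centeredX t m; apply: differentiable_continuous.
by apply/derivable1_diffP; exact: ex_derive.
Qed.

Lemma continuous_centeredX_bump nu t m : U01 t ->
  {for t, continuous (fun t => (t - 2^-1) ^+ m * bump t `^ nu)}.
Proof.
by move=> Ut; apply: cvgM; [exact: continuous_centeredX|exact: continuous_bump_powR].
Qed.

Lemma centered_bump_endpoints nu m : 0 < nu ->
  (bump_hi n - 2^-1) ^+ m * bump (bump_hi n) `^ nu -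
  (bump_lo n - 2^-1) ^+ m * bump (bump_lo n) `^ nu @[n --> \oo] --> 0.
Proof.
move=> nu0; have p0 := bump_powR_lo_cvg0 nu0.
under eq_fun do rewrite bump_powR_hi -mulrBl.
apply: norm_cvg0.
have up : 2 * bump (bump_lo n) `^ nu @[n --> \oo] --> 0.
  by rewrite -(mulr0 2); apply: cvgM; [exact: cvg_cst|].
apply: (squeeze_cvgr _ (cvg_cst 0) up); apply: nearW => n /=.
have [Uh Ul] : U01 (bump_hi n) /\ U01 (bump_lo n).
  have := @bump_lo_hi R n; have := @bump_lo_itv R n; rewrite /bump_hi /= !in_itv /=.
  by move=> /andP[? ?] ?; split; apply/andP; split; lra.
rewrite normr_ge0 normrM [`|_ `^ _|]ger0_norm ?powR_ge0// ler_wpM2r ?powR_ge0//.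
rewrite (le_trans (ler_normB _ _))//.
by rewrite -[leRHS]/(1 + 1) lerD// norm_centered_le1.
Qed.

Lemma bump_moment1 nu : 0 < nu -> bump_moment nu 1 = 0.
Proof.
move=> nu0.
have := @Rintegral_primitive _ _ open_U01 _ _ (@bump_lo_hi R) (@bump_itv_sub R)
  (fun t => - (nu *+ 2) * ((t - 2^-1) ^+ 1 * bump t `^ (nu - 1)))
  (fun t => bump t `^ nu) 0.
have i1 := integrable_bump_moment 1 nu0.
rewrite RintegralZl//; move=> h.
have {h} : - (nu *+ 2) * bump_moment nu 1 = 0.
  apply: h => //.
  - exact: bump_itv_near.
  - exact: integrable_EFinZl.
  - move=> t /set_mem Ut; apply: cvgM; first exact: cvg_cst.
    exact: continuous_centeredX_bump.
  - move=> t Ut; apply: (is_derive_eq (is_derive_bump_powR nu Ut)).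
    by rewrite expr1; field.
  - have := centered_bump_endpoints 0 nu0.
    by under eq_fun do rewrite !expr0 !mul1r.
move/eqP; rewrite mulf_eq0 oppr_eq0 mulrn_eq0 (gt_eqF nu0) /=.
by move/eqP.
Qed.

(** Integrate the derivative of (t - 1/2)^(m + 1) w^nu, which vanishes at both ends, and replace
    w^nu by (1/4 - (t - 1/2)^2) w^(nu - 1). *)
Lemma bump_momentSS nu m : 0 < nu ->
  (m.+1%:R + nu *+ 2) * bump_moment nu m.+2 = m.+1%:R / 4 * bump_moment nu m.
Proof.
move=> nu0; apply/esym/eqP; rewrite -subr_eq0; apply/eqP.
have i1 := integrable_bump_moment m nu0.
have i2 := integrable_bump_moment m.+2 nu0.
rewrite /bump_moment -!RintegralZl// -RintegralB//; try exact: integrable_EFinZl.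
apply: (@Rintegral_primitive _ _ open_U01 _ _ (@bump_lo_hi R) (@bump_itv_sub R)
  _ (fun t => (t - 2^-1) ^+ m.+1 * bump t `^ nu) 0).
- exact: bump_itv_near.
- by apply: integrable_EFinB => //; exact: integrable_EFinZl.
- move=> t /set_mem Ut; apply: cvgB; apply: cvgM; try exact: cvg_cst;
    exact: continuous_centeredX_bump.
- move=> t Ut; have d1 := is_derive_bump_powR nu Ut.
  have d2 := is_derive_centeredX t m.+1.
  apply: is_derive_eq; rewrite /GRing.scale /=.
  have -> : bump t `^ nu = bump t * bump t `^ (nu - 1).
    by rewrite mulr_powRB1// ltW// bump_gt0.
  by rewrite /bump !exprS; field.
- exact: (centered_bump_endpoints m.+1 nu0).
Qed.

(** The integral K nu of the opening comment, taken as a moment so that the recurrence applies to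
    it. *)
Definition bump_mass nu := bump_moment nu 0.

Lemma bump_massE nu : bump_mass nu = \int[mu]_(t in U01) (1 * bump t `^ (nu - 1)).
Proof. by apply: eq_Rintegral => t _; rewrite expr0. Qed.

(** One factor w = 1/4 - (t - 1/2)^2 turns the left side into the moments of orders 0 and 2, related
    by [bump_momentSS]. *)
Lemma bump_massS nu : 0 < nu -> bump_mass (nu + 1) = nu / (2 * (2 * nu + 1)) * bump_mass nu.
Proof.
move=> nu0.
have E : bump_mass (nu + 1) = 4^-1 * bump_mass nu - bump_moment nu 2.
  have i0 := integrable_bump_moment 0 nu0.
  have i2 := integrable_bump_moment 2 nu0.
  rewrite /bump_mass /bump_moment -RintegralZl// -RintegralB//; last exact: integrable_EFinZl.
  apply: eq_Rintegral => t /set_mem Ut; rewrite addrK !expr0 !mul1r.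
  rewrite -(mulr_powRB1 _ nu0); last exact: ltW (bump_gt0 Ut).
  by rewrite /bump; field.
have := bump_momentSS 0 nu0; rewrite -[bump_moment nu 0]/(bump_mass nu) => h.
have {}h : bump_moment nu 2 = bump_mass nu / (4 * (1 + nu *+ 2)).
  have n0 : 1 + nu *+ 2 != 0 by rewrite gt_eqF//; lra.
  apply: (mulfI n0); rewrite h; field.
  by rewrite gt_eqF//; lra.
rewrite E h; field; rewrite gt_eqF//; lra.
Qed.

Lemma lebesgue_U01 : mu U01 = 1%E.
Proof. by rewrite lebesgue_measure_itv /= lte01 oppr0 adde0. Qed.

Lemma lebesgue_U01_gt0 : (0 < mu U01)%E.
Proof. by rewrite lebesgue_U01 lte01. Qed.

Lemma bump_mass_gt0 nu : 0 < nu -> 0 < bump_mass nu.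
Proof.
move=> nu0; rewrite bump_massE; apply: Rintegral_gt0 => //.
- exact: lebesgue_U01_gt0.
- by have := integrable_bump_moment 0 nu0.
- by move=> t Ut; rewrite mul1r powR_gt0// bump_gt0.
Qed.

Lemma bump_mass1 : bump_mass 1 = 1.
Proof.
rewrite bump_massE subrr.
under eq_Rintegral do rewrite powRr0 mulr1.
transitivity (1 * fine (mu U01)); first exact: Rintegral_cst.
by rewrite lebesgue_U01 mul1r.
Qed.

(** By [bump_massS] the unit increment is ln y - ln 4 - ln (y + 1/2), whose own variation tends to
    0. *)
Lemma asym_affine_ln_bump_mass : asym_affine (fun nu => ln (bump_mass nu)).
Proof.
apply: asym_affine_convex.
- move=> x s x0 s01; rewrite !bump_massE.
  apply: (Rintegral_powR_le (v := cst 1) (w := bump)) => //=.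
  + exact: lebesgue_U01_gt0.
  + by move=> t; exact: bump_gt0.
  + move=> r /andP[xr _]; apply: (@integrable_bumpM _ 1); first exact: lt_le_trans xr.
      exact: measurable_cst.
    by move=> t _; rewrite normr1.
- move=> x s x0 /andP[s0 s1].
  have E (y : R) : 0 < y -> ln (bump_mass (y + 1)) - ln (bump_mass y) =
      ln (1 * y) - ln 4 - ln (1 * (y + 2^-1)).
    move=> y0; rewrite -!ln_div ?posrE ?bump_mass_gt0 ?divr_gt0//; try lra.
    rewrite bump_massS// mulfK ?gt_eqF ?bump_mass_gt0//; congr ln; field.
    by rewrite !gt_eqF//; lra.
  have xn n : 0 < x + n%:R by rewrite ltr_wpDr.
  have h1 := lnD_sub_cvg0 (@ltr01 R) x0 s0.
  have x2 : 0 < x + 2^-1 by lra.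
  have h2 := lnD_sub_cvg0 (@ltr01 R) x2 s0.
  have := cvgB h1 h2; rewrite subr0 => h.
  apply: (cvg_trans _ (h _)); apply: near_eq_cvg; apply: nearW => n.
  have xns : 0 < x + n%:R + s by rewrite ltr_wpDr.
  rewrite (E _ (xn n)) (E _ xns) !fctE.
  rewrite (addrAC x _ n%:R) (addrAC (x + n%:R) _ s); lra.
Qed.

End bump_moments.

(** * Euler's integral *)

Section euler_gamma_theory.
Context {R : realType}.
Notation mu := (@lebesgue_measure R).
Notation U0y := (`]0%R, +oo[%classic : set R).
Implicit Types (x t : R).

Lemma open_U0y : open U0y.
Proof. exact: interval_open. Qed.

Lemma gt0_U0y t : U0y t -> 0 < t.
Proof. by rewrite /= in_itv /= andbT. Qed.

Definition ray_lo (n : nat) : R := n.+2%:R^-1.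
Definition ray_hi (n : nat) : R := n.+2%:R.

Lemma ray_lo_gt0 n : 0 < ray_lo n.
Proof. by rewrite /ray_lo invr_gt0 ltr0n. Qed.

Lemma ray_lo_le1 n : ray_lo n <= 1.
Proof. by rewrite /ray_lo invf_le1 ?ltr0n// ler1n. Qed.

Lemma ray_lo_hi n : ray_lo n < ray_hi n.
Proof. by apply: (le_lt_trans (ray_lo_le1 n)); rewrite /ray_hi ltr1n. Qed.

Lemma ray_lo_cvg0 : ray_lo n @[n --> \oo] --> 0.
Proof.
apply/gtr0_cvgV0; first by apply: nearW => n; rewrite ltr0n.
apply/cvgryPge => A; near=> n.
apply: (@le_trans _ _ n%:R); last by rewrite ler_nat -addn2 leq_addr.
by near: n; exact: nbhs_infty_ger.
Unshelve. all: by end_near. Qed.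

Lemma ray_itv_sub n : `[ray_lo n, ray_hi n] `<=` U0y.
Proof.
move=> t; rewrite /= !in_itv /= andbT => /andP[h _].
exact: lt_le_trans (ray_lo_gt0 n) h.
Qed.

Lemma ray_itv_nd : nondecreasing_seq (fun n => `[ray_lo n, ray_hi n]%classic).
Proof.
apply/nondecreasing_seqP => n; apply/subsetPset => t; rewrite /= !in_itv /=.
move=> /andP[h1 h2]; apply/andP; split.
  by apply: le_trans h1; rewrite lef_pV2 ?posrE ?ltr0n// ler_nat.
by apply: (le_trans h2); rewrite ler_nat.
Qed.

Lemma ray_itv_near t : U0y t -> \forall n \near \oo, `[ray_lo n, ray_hi n]%classic t.
Proof.
move=> /gt0_U0y t0; near=> n; rewrite /= in_itv /=; apply/andP; split.
  by near: n; have := cvgr_le 0 ray_lo_cvg0; exact.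
apply: (@le_trans _ _ n%:R); last by rewrite ler_nat -addn2 leq_addr.
by near: n; exact: nbhs_infty_ger.
Unshelve. all: by end_near. Qed.

Lemma ray_itv_cover : U0y `<=` \bigcup_n `[ray_lo n, ray_hi n]%classic.
Proof. by move=> t /ray_itv_near[n _ /(_ n (leqnn n))]; exists n. Qed.

Lemma expR_half_ray_hi_cvg0 : expR (- (ray_hi n / 2)) @[n --> \oo] --> 0.
Proof.
have up : 2 * ray_lo n @[n --> \oo] --> 0.
  by rewrite -(mulr0 2); apply: cvgM; [exact: cvg_cst|exact: ray_lo_cvg0].
apply: (squeeze_cvgr _ (cvg_cst 0) up); apply: nearW => n.
rewrite expR_ge0 -(ler_pM2r (expR_gt0 (ray_hi n / 2))) -expRD addNr expR0 /=.
have l0 := ray_lo_gt0 n; have h0 : 0 < 2 * ray_lo n by rewrite mulr_gt0.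
apply: (@le_trans _ _ (2 * ray_lo n * (ray_hi n / 2))).
  rewrite -[ray_lo n]/((ray_hi n)^-1) le_eqVlt; apply/orP; left; apply/eqP; field.
  by rewrite gt_eqF// ltr0n.
by rewrite ler_pM2l//; apply: le_trans (expR_ge1Dx _); rewrite lerDr.
Qed.

(* The maximum of [x ln t - t / 2] is at [t = 2 x]. *)
Lemma powR_le_expR_half x t : 0 < x -> 0 < t ->
  t `^ x <= expR (x * ln (2 * x)) * expR (t / 2).
Proof.
move=> x0 t0; rewrite -expRD powR_gt0E// ler_expR.
have u0 : 0 < t / (2 * x) by rewrite divr_gt0// mulr_gt0.
have := ln_sublinear u0; rewrite ln_div ?posrE ?mulr_gt0// => /ltW.
rewrite lerBlDl => /(ler_wpM2l (ltW x0)); rewrite mulrDr => /le_trans; apply.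
by rewrite lerD2l le_eqVlt; apply/orP; left; apply/eqP; field; rewrite gt_eqF.
Qed.

Let C x : R := expR (x * ln (2 * x)).

Lemma powR_expRN_le x t : 0 < x -> 0 < t -> t `^ x * expR (- t) <= C x * expR (- (t / 2)).
Proof.
move=> x0 t0; rewrite -(ler_pM2r (expR_gt0 t)) -!mulrA -(expRD (- t)) addNr expR0 mulr1.
rewrite -(expRD (- (t / 2))).
by rewrite (_ : - (t / 2) + t = t / 2); [exact: powR_le_expR_half|field].
Qed.

Lemma is_derive_powR x t : 0 < t ->
  is_derive t 1 (fun t => t `^ x) (x * t `^ (x - 1)).
Proof.
move=> t0; apply: DeriveDef; first by apply: derivable_powR; rewrite in_itv /= andbT.
by rewrite -derive1E powR_derive1// in_itv /= andbT.
Qed.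

Lemma is_derive_expRM (k t : R) :
  is_derive t 1 (fun t => expR (k * t)) (k * expR (k * t)).
Proof. by apply: is_derive_eq; rewrite /GRing.scale /=; ring. Qed.

Lemma continuous_powR_gt0 x t : 0 < t -> {for t, continuous (fun t => t `^ x)}.
Proof.
move=> t0; have d := is_derive_powR x t0; apply: differentiable_continuous.
by apply/derivable1_diffP; exact: ex_derive.
Qed.

Lemma continuous_gamma_integrand x t : 0 < t ->
  {for t, continuous (fun t => expR (- t) * t `^ x)}.
Proof.
move=> t0; apply: cvgM.
  by apply: continuous_comp; [exact: opp_continuous|exact: continuous_expR].
exact: continuous_powR_gt0.
Qed.

Lemma measurable_gamma_integrand D x : measurable_fun D (fun t => expR (- t) * t `^ x).
Proof.
apply: measurable_funTS; apply: measurable_funM.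
  by apply: measurableT_comp => //; exact: measurable_oppr.
exact: measurable_powR.
Qed.

Lemma integrable_gamma x : 0 < x ->
  mu.-integrable U0y (EFin \o (fun t => expR (- t) * t `^ (x - 1))).
Proof.
move=> x0; have C0 : 0 < C x by exact: expR_gt0.
(* The derivative of t^x e^(-t) / x is the integrand minus t^x e^(-t) / x. The second term of [H]
   adds C e^(-t/2) / x to the derivative, which outweighs this loss by [powR_expRN_le]. *)
pose H t := x^-1 * (t `^ x * expR (- 1 * t) - 2 * C x * expR (- 2^-1 * t)).
pose h t := expR (- t) * t `^ (x - 1) +
  x^-1 * (C x * expR (- 2^-1 * t) - expR (- t) * t `^ x).
have NhE t : - 2^-1 * t = - (t / 2) by rewrite mulNr mulrC.
apply: (integrable_le_primitive open_U0y ray_lo_hi (@ray_itv_sub) (h := h) (H := H)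
  (M := x^-1 * (C x + 2 * C x)) ray_itv_nd ray_itv_cover).
- exact: measurable_gamma_integrand.
- move=> t /gt0_U0y t0; rewrite ger0_norm ?mulr_ge0 ?expR_ge0 ?powR_ge0// lerDl.
  rewrite mulr_ge0 ?invr_ge0 ?(ltW x0)// subr_ge0 NhE mulrC.
  exact: powR_expRN_le.
- move=> t /set_mem /gt0_U0y t0; apply: cvgD; first exact: continuous_gamma_integrand.
  apply: cvgM; first exact: cvg_cst.
  apply: cvgB; last exact: continuous_gamma_integrand.
  apply: cvgM; first exact: cvg_cst.
  have d := is_derive_expRM (- 2^-1) t.
  have : {for t, continuous (fun t => expR (- 2^-1 * t))}.
    by apply: differentiable_continuous; apply/derivable1_diffP; exact: ex_derive.
  by apply.
- move=> t /gt0_U0y t0.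
  have d1 := is_derive_powR x t0.
  have d2 := is_derive_expRM (- 2^-1) t; have d3 := is_derive_expRM (- 1) t.
  rewrite /H; apply: is_derive_eq; rewrite /GRing.scale /= /h mulN1r.
  by field; rewrite gt_eqF.
- move=> n; have l0 := ray_lo_gt0 n.
  have h0 : 0 < ray_hi n by exact: lt_trans (ray_lo_hi n).
  rewrite /H -mulrBr ler_wpM2l ?invr_ge0 ?(ltW x0)// !NhE !mulN1r.
  have e1 : expR (- (ray_hi n / 2)) <= 1 by rewrite -expR0 ler_expR oppr_le0 divr_ge0 ?ltW.
  have e2 : expR (- (ray_lo n / 2)) <= 1 by rewrite -expR0 ler_expR oppr_le0 divr_ge0 ?ltW.
  have e3 := expR_ge0 (- (ray_hi n / 2)).
  have p1 := powR_expRN_le x0 h0.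
  have p2 : 0 <= ray_lo n `^ x * expR (- ray_lo n) by rewrite mulr_ge0 ?powR_ge0 ?expR_ge0.
  nra.
Qed.

Lemma euler_gammaE x : euler_gamma x = \int[mu]_(t in U0y) (expR (- t) * t `^ (x - 1)).
Proof. by apply: eq_Rintegral => t _; rewrite mulrC. Qed.

Lemma lebesgue_U0y_gt0 : (0 < mu U0y)%E.
Proof. by rewrite lebesgue_measure_itv /= ltry addye// ltry. Qed.

Lemma euler_gamma_gt0 x : 0 < x -> 0 < euler_gamma x.
Proof.
move=> x0; rewrite euler_gammaE; apply: Rintegral_gt0 => //.
- exact: lebesgue_U0y_gt0.
- exact: integrable_gamma.
- by move=> t /gt0_U0y t0; rewrite mulr_gt0 ?expR_gt0 ?powR_gt0.
Qed.

(** The difference of the two sides is the integral of the derivative of t^x e^(-t), which tends to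
    0 at both ends. *)
Lemma euler_gammaS x : 0 < x -> euler_gamma (x + 1) = x * euler_gamma x.
Proof.
move=> x0; apply/esym/eqP; rewrite -subr_eq0; apply/eqP.
have x10 : 0 < x + 1 by lra.
have i1 := integrable_gamma x0; have i2 := integrable_gamma x10.
rewrite !euler_gammaE -RintegralZl// -RintegralB//; last exact: integrable_EFinZl.
apply: (@Rintegral_primitive _ _ open_U0y _ _ ray_lo_hi (@ray_itv_sub)
  _ (fun t => t `^ x * expR (- 1 * t)) 0).
- exact: ray_itv_near.
- by apply: integrable_EFinB => //; exact: integrable_EFinZl.
- move=> t /set_mem /gt0_U0y t0; apply: cvgB; last exact: continuous_gamma_integrand.
  by apply: cvgM; [exact: cvg_cst|exact: continuous_gamma_integrand].
- move=> t /gt0_U0y t0; have d1 := is_derive_powR x t0; have d3 := is_derive_expRM (- 1) t.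
  by apply: is_derive_eq; rewrite /GRing.scale /= addrK mulN1r; ring.
- rewrite -[X in _ --> X](subr0 0); apply: cvgB.
    have up : C x * expR (- (ray_hi n / 2)) @[n --> \oo] --> 0.
      by rewrite -(mulr0 (C x)); apply: cvgM; [exact: cvg_cst|exact: expR_half_ray_hi_cvg0].
    apply: (squeeze_cvgr _ (cvg_cst 0) up); apply: nearW => n.
    rewrite mulN1r mulr_ge0 ?powR_ge0 ?expR_ge0//= powR_expRN_le//.
  have up : ray_lo n `^ x @[n --> \oo] --> 0.
    have /cvg_at_rightP := powR_cvg0 x0; apply; split; last exact: ray_lo_cvg0.
    exact: ray_lo_gt0.
  apply: (squeeze_cvgr _ (cvg_cst 0) up); apply: nearW => n.
  rewrite mulN1r mulr_ge0 ?powR_ge0 ?expR_ge0//= ler_piMr ?powR_ge0//.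
  by rewrite -expR0 ler_expR oppr_le0 ltW// ray_lo_gt0.
Qed.

Lemma euler_gamma1 : euler_gamma 1 = 1 :> R.
Proof.
rewrite euler_gammaE; have i1 := integrable_gamma (@ltr01 R).
apply: (@Rintegral_primitive _ _ open_U0y _ _ ray_lo_hi (@ray_itv_sub)
  _ (fun t => - expR (- 1 * t)) 1) => //.
- exact: ray_itv_near.
- by move=> t /set_mem /gt0_U0y t0; exact: continuous_gamma_integrand.
- move=> t /gt0_U0y t0; have d3 := is_derive_expRM (- 1) t.
  by apply: is_derive_eq; rewrite subrr powRr0 !mulN1r opprK mulr1.
- rewrite -[X in _ --> X](add0r 1) -[X in _ --> X + _]oppr0; apply: cvgD.
    apply: cvgN; apply: (squeeze_cvgr _ (cvg_cst 0) expR_half_ray_hi_cvg0).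
    apply: nearW => n; rewrite mulN1r expR_ge0 ler_expR lerN2 ler_pdivrMr// mulr2n mulrDr mulr1.
    by rewrite lerDl ltW// (lt_trans (ray_lo_gt0 n))// ray_lo_hi.
  under eq_fun do rewrite opprK mulN1r.
  rewrite -expR0 -oppr0.
  by apply: continuous_cvg; [exact: continuous_expR|apply: cvgN; exact: ray_lo_cvg0].
Qed.

End euler_gamma_theory.

(** * Beta-gamma relation and duplication formula *)

Section duplication.
Context {R : realType}.
Notation mu := (@lebesgue_measure R).
Notation U0y := (`]0%R, +oo[%classic : set R).
Implicit Types (x t : R).

Lemma asym_affine_shift (phi : R -> R) (k : R) : 0 <= k -> asym_affine phi ->
  asym_affine (fun x => phi (x + k)).
Proof.
move=> k0 hphi x s x0 s01; have xk : 0 < x + k by rewrite ltr_wpDr.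
have := hphi (x + k) s xk s01.
by under eq_fun do rewrite !(addrAC x k) !(addrAC _ k).
Qed.

Lemma asym_affine_ln_gamma : asym_affine (fun x : R => ln (euler_gamma x)).
Proof.
apply: asym_affine_convex.
- move=> x s x0 s01; rewrite !euler_gammaE.
  apply: (Rintegral_powR_le (v := fun t => expR (- t)) (w := id)) => //=.
  + exact: lebesgue_U0y_gt0.
  + by move=> t _; exact: expR_gt0.
  + by move=> t /gt0_U0y.
  + by move=> r /andP[xr _]; apply: integrable_gamma; exact: lt_le_trans xr.
- move=> x s x0 /andP[s0 s1].
  have xn n : 0 < x + n%:R by rewrite ltr_wpDr.
  have E (y : R) : 0 < y -> ln (euler_gamma (y + 1)) - ln (euler_gamma y) = ln (1 * y).
    move=> y0; rewrite -ln_div ?posrE ?euler_gamma_gt0//; last by rewrite addr_gt0.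
    by rewrite euler_gammaS// mulfK ?mul1r// gt_eqF// euler_gamma_gt0.
  have := lnD_sub_cvg0 (@ltr01 R) x0 s0.
  by under eq_fun do rewrite -!E ?ltr_wpDr//.
Qed.

(** Writing t^(2x - 1) as (t^2)^(x - 1/2) gives the exponent slope 1 in x, so that the log-convexity
    lemma applies with base t^2; two functional equations give the unit increment. *)
Lemma asym_affine_ln_gamma_double : asym_affine (fun x : R => ln (euler_gamma (2 * x))).
Proof.
have GE x : euler_gamma (2 * x) =
    \int[mu]_(t in U0y) (expR (- t) * (t ^+ 2) `^ (x - 2^-1)).
  rewrite euler_gammaE; apply: eq_Rintegral => t /set_mem /gt0_U0y t0.
  by rewrite -(powR_mulrn _ (ltW t0)) -powRrM; congr (_ * _ `^ _); field.
apply: asym_affine_convex.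
- move=> x s x0 s01; rewrite !GE.
  apply: (Rintegral_powR_le (v := fun t => expR (- t)) (w := fun t => t ^+ 2)) => //=.
  + exact: lebesgue_U0y_gt0.
  + by move=> t _; exact: expR_gt0.
  + by move=> t /gt0_U0y t0; rewrite exprn_gt0.
  + move=> r /andP[xr _].
    have r0 : 0 < 2 * r by rewrite mulr_gt0// (lt_le_trans x0).
    apply: eq_integrable (integrable_gamma r0) => // t /set_mem /gt0_U0y t0 /=.
    by rewrite -(powR_mulrn _ (ltW t0)) -powRrM; congr (_ * _ `^ _)%:E; field.
- move=> x s x0 /andP[s0 s1].
  have xn n : 0 < x + n%:R by rewrite ltr_wpDr.
  have E (y : R) : 0 < y -> ln (euler_gamma (2 * (y + 1))) - ln (euler_gamma (2 * y)) =
      ln (2 * y) + ln (2 * (y + 2^-1)).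
    move=> y0; have y2 : 0 < 2 * y by rewrite mulr_gt0.
    have y21 : 0 < 2 * y + 1 by rewrite addr_gt0.
    have -> : 2 * (y + 1) = 2 * y + 1 + 1 by ring.
    have -> : 2 * (y + 2^-1) = 2 * y + 1 by field.
    rewrite -ln_div ?posrE ?euler_gamma_gt0 ?addr_gt0//.
    rewrite !euler_gammaS// mulrA mulfK; last by rewrite gt_eqF// euler_gamma_gt0.
    by rewrite lnM ?posrE// addrC.
  have x2 : 0 < x + 2^-1 by rewrite addr_gt0// invr_gt0.
  have h1 := lnD_sub_cvg0 (@ltr0Sn R 1) x0 s0.
  have h2 := lnD_sub_cvg0 (@ltr0Sn R 1) x2 s0.
  have := cvgD h1 h2; rewrite addr0 => h.
  apply: (cvg_trans _ (h _)); apply: near_eq_cvg; apply: nearW => n.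
  have xns : 0 < x + n%:R + s by rewrite ltr_wpDr.
  rewrite (E _ (xn n)) (E _ xns) !fctE.
  rewrite (addrAC x _ n%:R) (addrAC (x + n%:R) _ s); ring.
Qed.

(** The ratio K(x) Gamma(2x) / Gamma(x)^2 is invariant under x -> x + 1, the factors being x / (2
    (2x + 1)), 2x (2x + 1) and x^2. Its value at 1 fixes the constant. *)
Lemma bump_mass_gamma x : 0 < x ->
  bump_mass x = euler_gamma x * euler_gamma x / euler_gamma (2 * x).
Proof.
move=> x0; have x20 : 0 < 2 * x by rewrite mulr_gt0.
pose phi y := ln (bump_mass y) + ln (euler_gamma (2 * y)) + -2 * ln (euler_gamma y) : R.
have aphi : asym_affine phi.
  apply: asym_affineD; last by apply: asym_affineZ; exact: asym_affine_ln_gamma.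
  apply: asym_affineD; [exact: asym_affine_ln_bump_mass|exact: asym_affine_ln_gamma_double].
have phiE (y : R) : 0 < y -> phi y =
    ln (bump_mass y * euler_gamma (2 * y) / (euler_gamma y * euler_gamma y)).
  move=> y0; have y2 : 0 < 2 * y by rewrite mulr_gt0.
  move: (bump_mass_gt0 y0) (euler_gamma_gt0 y0) (euler_gamma_gt0 y2); rewrite /phi.
  move: (bump_mass y) (euler_gamma y) (euler_gamma (2 * y)) => k g g' k0 g0 g'0.
  by rewrite ln_div ?posrE ?mulr_gt0// !lnM ?posrE//; ring.
have p1 (y : R) : 0 < y -> phi (y + 1) = phi y.
  move=> y0; have y1 : 0 < y + 1 by rewrite addr_gt0.
  have y2 : 0 < 2 * y by rewrite mulr_gt0.
  have y21 : 0 < 2 * y + 1 by rewrite addr_gt0.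
  rewrite (phiE _ y0) (phiE _ y1); congr ln.
  have -> : 2 * (y + 1) = 2 * y + 1 + 1 by ring.
  rewrite !euler_gammaS// bump_massS//.
  move: (euler_gamma_gt0 y0); move: (bump_mass y) (euler_gamma y) => k g g0.
  by field; rewrite !gt_eqF.
have := periodic_asym_affine_cst aphi p1 x0.
rewrite (phiE x x0) (phiE 1 (@ltr01 R)) bump_mass1.
have -> : 2 * 1 = 1 + 1 :> R by ring.
rewrite (euler_gammaS (@ltr01 R)) euler_gamma1 !mulr1 divr1 ln1.
have g1 := euler_gamma_gt0 x0; have g2 := euler_gamma_gt0 x20; have k0 := bump_mass_gt0 x0.
move/eqP; rewrite ln_eq0; last exact: divr_gt0 (mulr_gt0 k0 g2) (mulr_gt0 g1 g1).
move: (bump_mass x) (euler_gamma x) (euler_gamma (2 * x)) k0 g1 g2 => k g g' _ g0 g'0 /eqP h.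
rewrite -[RHS]mulr1 -h; field.
by rewrite !gt_eqF.
Qed.

(** With [bump_mass_gamma] this is Legendre's duplication formula. The constant is left unevaluated,
    since it disappears from logarithmic derivatives. *)
Lemma bump_mass_duplication : exists2 c : R, 0 < c & forall x, 0 < x ->
  bump_mass x * euler_gamma (x + 2^-1) * 4 `^ x = c * euler_gamma x.
Proof.
have h2 : (0 : R) < 2^-1 by rewrite invr_gt0.
pose phi y := ln (bump_mass y) + ln (euler_gamma (y + 2^-1)) + y * ln 4
  + -1 * ln (euler_gamma y) : R.
have aphi : asym_affine phi.
  apply: asym_affineD; last by apply: asym_affineZ; exact: asym_affine_ln_gamma.
  apply: asym_affineD; last exact: asym_affine_linear.
  apply: asym_affineD; first exact: asym_affine_ln_bump_mass.
  exact: asym_affine_shift (ltW h2) asym_affine_ln_gamma.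
have pos (y : R) : 0 < y -> 0 < bump_mass y * euler_gamma (y + 2^-1) * 4 `^ y.
  move=> y0; apply: mulr_gt0; last by rewrite powR_gt0.
  by apply: mulr_gt0; [exact: bump_mass_gt0|apply: euler_gamma_gt0; rewrite addr_gt0].
have phiE (y : R) : 0 < y -> phi y =
    ln (bump_mass y * euler_gamma (y + 2^-1) * 4 `^ y / euler_gamma y).
  move=> y0; have y2 : 0 < y + 2^-1 by rewrite addr_gt0.
  move: (bump_mass_gt0 y0) (euler_gamma_gt0 y0) (euler_gamma_gt0 y2); rewrite /phi.
  move: (bump_mass y) (euler_gamma y) (euler_gamma (y + 2^-1)) => k g g' k0 g0 g'0.
  have f0 : 0 < 4 `^ y :> R by rewrite powR_gt0.
  by rewrite ln_div ?posrE ?mulr_gt0// !lnM ?posrE ?mulr_gt0// ln_powR; ring.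
have p1 (y : R) : 0 < y -> phi (y + 1) = phi y.
  move=> y0; have y2 : 0 < y + 2^-1 by rewrite addr_gt0.
  have y1 : 0 < y + 1 by rewrite addr_gt0.
  rewrite (phiE _ y0) (phiE _ y1); congr ln.
  rewrite (addrAC y) !euler_gammaS// bump_massS// powRD ?powRr1//; last first.
    by rewrite pnatr_eq0 implybT.
  move: (euler_gamma_gt0 y0); move: (bump_mass y) (euler_gamma y) => k g g0.
  by field; rewrite !gt_eqF//; lra.
exists (expR (phi 1)); first exact: expR_gt0.
move=> x x0; rewrite -(periodic_asym_affine_cst aphi p1 x0) (phiE _ x0).
have g0 := euler_gamma_gt0 x0; have p0 := pos _ x0.
by rewrite lnK ?posrE; [rewrite mulfVK// gt_eqF|exact: divr_gt0].
Qed.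

End duplication.

(** * The Bessel series *)

Section bessel_series.
Context {R : realType}.
Notation mu := (@lebesgue_measure R).
Notation U01 := (`]0%R, 1%R[%classic : set R).
Implicit Types (nu x t : R) (n k : nat).

Lemma gamma_euler x : 0 < x -> gamma x = euler_gamma x.
Proof. by rewrite /gamma => ->. Qed.

Lemma bump_moment_odd nu k : 0 < nu -> bump_moment nu k.*2.+1 = 0.
Proof.
move=> nu0; elim: k => [|k ih]; first exact: bump_moment1.
have := bump_momentSS k.*2.+1 nu0; rewrite ih mulr0 => /eqP.
rewrite mulf_eq0 gt_eqF/=; first by move/eqP.
by rewrite addr_gt0 ?ltr0n// mulrn_wgt0.
Qed.

(** Passing from k to k + 1 multiplies both sides by x^2 / (16 (k + 1) (nu + 1/2 + k)). The last
    factor on the right is, up to a fixed power of |x| / 4, the Bessel term of order nu - 1/2 at |x|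
    / 2. *)
Lemma bump_moment_even nu x k : 0 < nu ->
  x ^+ k.*2 / (k.*2)`!%:R * bump_moment nu k.*2 =
  bump_mass nu * euler_gamma (nu + 2^-1) *
    ((x / 4) ^+ k.*2 / (k`!%:R * euler_gamma (nu + 2^-1 + k%:R))).
Proof.
move=> nu0; have nu2 : 0 < nu + 2^-1 by rewrite addr_gt0// invr_gt0.
elim: k => [|k ih].
  rewrite double0 !expr0 !fact0 addr0 !divr1 !mul1r mulfK//.
  by rewrite gt_eqF// euler_gamma_gt0.
have nuk : 0 < nu + 2^-1 + k%:R by rewrite ltr_wpDr.
have d0 : 0 < k.*2.+1%:R + nu *+ 2 by rewrite addr_gt0 ?ltr0n// mulrn_wgt0.
have E : bump_moment nu k.*2.+2 = k.*2.+1%:R / 4 / (k.*2.+1%:R + nu *+ 2) * bump_moment nu k.*2.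
  apply: (mulfI (lt0r_neq0 d0)); rewrite bump_momentSS//.
  by rewrite mulrA mulrCA divff ?mulr1// gt_eqF.
rewrite doubleS E -[k.+1%:R]natr1 (addrA (nu + 2^-1)) euler_gammaS//.
rewrite !factS !natrM.
have -> : x ^+ k.*2.+2 = x ^+ 2 * x ^+ k.*2 by rewrite -exprD.
have -> : (x / 4) ^+ k.*2.+2 = (x / 4) ^+ 2 * (x / 4) ^+ k.*2 by rewrite -exprD.
have f1 : k`!%:R != 0 :> R by rewrite pnatr_eq0 -lt0n fact_gt0.
have f2 : k.*2`!%:R != 0 :> R by rewrite pnatr_eq0 -lt0n fact_gt0.
have g0 := lt0r_neq0 (euler_gamma_gt0 nuk).
transitivity (x ^+ 2 / (16 * k.+1%:R * (nu + 2^-1 + k%:R)) *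
   (x ^+ k.*2 / (k.*2)`!%:R * bump_moment nu k.*2)).
  move: (bump_moment nu k.*2) f2 d0 => N f2 d0.
  move: (x ^+ k.*2) (k.*2`!%:R) f2 => X F f2.
  have -> : k.*2.+2%:R = 2 * (k%:R + 1) :> R by rewrite -addn2 natrD -muln2 natrM; ring.
  move: d0; have -> : k.*2.+1%:R = 2 * k%:R + 1 :> R by rewrite -addn1 natrD -muln2 natrM; ring.
  rewrite -[k.+1%:R]natr1; have : (0 : R) <= k%:R by rewrite ler0n.
  move: (k%:R : R) nuk => r nuk r0 d0.
  by field; rewrite f2 !gt_eqF//=; lra.
rewrite ih.
move: (bump_mass nu) (euler_gamma (nu + 2^-1)) (euler_gamma (nu + 2^-1 + k%:R)) g0 => K G G' g0.
move: ((x / 4) ^+ k.*2) (k`!%:R) f1 => X F f1.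
rewrite -[k.+1%:R]natr1; have : (0 : R) <= k%:R by rewrite ler0n.
move: (k%:R : R) nuk => r nuk r0.
by field; rewrite f1 g0 !gt_eqF//=; lra.
Qed.

Lemma series_exp_coeff_le x n : `|series (exp_coeff x) n| <= expR `|x|.
Proof.
apply: (@le_trans _ _ (series (exp_coeff `|x|) n)).
  rewrite /series /=; apply: (le_trans (ler_norm_sum _ _ _)).
  by apply: ler_sum => i _; rewrite /exp_coeff /= normrM normrX [`|_^-1|]ger0_norm.
apply: nondecreasing_cvgn_le; last exact: is_cvg_series_exp_coeff.
apply/nondecreasing_seqP => m; rewrite -subr_ge0 /series /= big_nat_recr//= addrAC subrr add0r.
by rewrite /exp_coeff /= divr_ge0.
Qed.

Lemma measurable_exp_coeff_series D x n :
  measurable_fun D (fun t => series (exp_coeff (x * (t - 2^-1))) n).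
Proof.
rewrite /series /=; apply: measurable_sum => i.
rewrite /exp_coeff /=; apply: measurable_funM => //.
by apply: measurable_funX; apply: measurable_funM => //; apply: measurable_funB.
Qed.

(** Dominated convergence: on ]0, 1[ the partial sums of the exponential are bounded by exp |x|,
    because |t - 1/2| <= 1. *)
Lemma bump_exp_series_cvg nu x : 0 < nu ->
  series (fun j => x ^+ j / j`!%:R * bump_moment nu j) n @[n --> \oo] -->
  \int[mu]_(t in U01) (expR (x * (t - 2^-1)) * bump t `^ (nu - 1)).
Proof.
move=> nu0.
pose f n t := series (exp_coeff (x * (t - 2^-1))) n * bump t `^ (nu - 1).
have xt t : U01 t -> `|x * (t - 2^-1)| <= `|x|.
  move=> /(norm_centered_le1 1); rewrite expr1 normrM => /(ler_wpM2l (normr_ge0 x)).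
  by rewrite mulr1.
have fb n t : U01 t -> `|series (exp_coeff (x * (t - 2^-1))) n| <= expR `|x|.
  move=> Ut; apply: (le_trans (series_exp_coeff_le _ _)).
  by rewrite ler_expR xt.
have fi n : mu.-integrable U01 (EFin \o f n).
  apply: (@integrable_bumpM _ _ (expR `|x|)) => //; first exact: measurable_exp_coeff_series.
  by move=> t; exact: fb.
have gi : mu.-integrable U01 (EFin \o (fun t => expR (x * (t - 2^-1)) * bump t `^ (nu - 1))).
  apply: (@integrable_bumpM _ _ (expR `|x|)) => //.
    apply: measurableT_comp => //.
    by apply: measurable_funM => //; apply: measurable_funB.
  by move=> t /xt h; rewrite ger0_norm ?expR_ge0// ler_expR (le_trans (ler_norm _)).
have Ef n : \int[mu]_(t in U01) f n t = series (fun j => x ^+ j / j`!%:R * bump_moment nu j) n.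
  elim: n => [|n ih].
    rewrite /series /= big_geq//; under eq_Rintegral do rewrite /f /series /= big_geq// mul0r.
    by rewrite Rintegral_cst// mul0r.
  rewrite seriesSr -ih -RintegralZl//; last exact: integrable_bump_moment.
  rewrite -RintegralD//.
  - apply: eq_Rintegral => t _; rewrite /f seriesSr mulrDl; congr (_ + _).
    by rewrite /exp_coeff /= exprMn; ring.
  - by apply: integrable_EFinZl => //; exact: integrable_bump_moment.
have cv : ((\int[mu]_(t in U01) (f n t)%:E) @[n --> \oo] -->
    \int[mu]_(t in U01) (expR (x * (t - 2^-1)) * bump t `^ (nu - 1))%:E)%E.
  apply: (@dominated_cvg _ _ _ mu _ _ _ _ (fun t => (expR `|x| * bump t `^ (nu - 1))%:E)) => //.
  - by move=> n; exact: measurable_int (fi n).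
  - move=> t Ut; apply: cvg_EFin; first exact: nearW.
    apply: cvgM; last exact: cvg_cst.
    exact: is_cvg_series_exp_coeff.
  - by apply: integrable_EFinZl => //; exact: integrable_bump_powR.
  - move=> n t Ut; rewrite lee_fin normrM [`|_ `^ _|]ger0_norm ?powR_ge0//.
    by rewrite ler_wpM2r ?powR_ge0// fb.
under eq_fun do rewrite -Ef.
apply: fine_cvg; rewrite fineK//; exact: integrable_fin_num.
Qed.

Lemma besselI_cvg nu x : 0 < nu -> x != 0 ->
  bump_mass nu * gamma (nu + 2^-1) * (`|x| / 4) `^ (- (nu - 2^-1)) *
    series (besselI_term (nu - 2^-1) (`|x| / 2)) n @[n --> \oo] -->
  \int[mu]_(t in U01) (expR (x * (t - 2^-1)) * bump t `^ (nu - 1)).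
Proof.
move=> nu0 x0; have nu2 : 0 < nu + 2^-1 by rewrite addr_gt0// invr_gt0.
have z0 : 0 < `|x| / 4 by rewrite divr_gt0// normr_gt0.
have h := bump_exp_series_cvg (x := x) nu0.
(* Only even partial sums are kept: as odd moments vanish, the first 2n terms amount to n Bessel
   terms. *)
have : (fun n => series (fun j => x ^+ j / j`!%:R * bump_moment nu j) n.*2) @ \oo -->
    \int[mu]_(t in U01) (expR (x * (t - 2^-1)) * bump t `^ (nu - 1)).
  apply: (cvg_comp _ _ _ h) => A [N _ NA]; exists N => // n /= Nn; apply: NA => /=.
  by rewrite (leq_trans Nn)// -addnn leq_addr.
apply: cvg_trans; apply: near_eq_cvg; apply: nearW; elim => [|n ih].
  by rewrite /series /= !big_geq// mulr0.
rewrite doubleS !seriesSr mulrDr -ih; rewrite bump_moment_odd// mulr0 addr0; congr (_ + _).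
rewrite bump_moment_even// gamma_euler// -!mulrA; congr (_ * (_ * _)).
rewrite /besselI_term; have -> : `|x| / 2 / 2 = `|x| / 4 by field.
rewrite powRD; last by rewrite (gt_eqF z0) implybT.
rewrite powRN -mulrA mulKf ?gt_eqF ?powR_gt0//.
rewrite powR_mulrn ?ltW// (_ : nu - 2^-1 + n%:R + 1 = nu + 2^-1 + n%:R); last by field.
rewrite gamma_euler ?ltr_wpDr//; congr (_ / _).
by rewrite -[in LHS]mul2n -[in RHS]mul2n !exprM !expr_div_n real_normK ?num_real.
Qed.

Lemma bump_exp_integral nu x : 0 < nu -> x != 0 ->
  \int[mu]_(t in U01) (expR (x * t) * bump t `^ (nu - 1)) =
  bump_mass nu * (4 / `|x|) `^ (nu - 2^-1) * expR (x / 2) * gamma (nu + 2^-1) *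
    besselI (nu - 2^-1) (`|x| / 2).
Proof.
move=> nu0 x0; have nu2 : 0 < nu + 2^-1 by rewrite addr_gt0// invr_gt0.
have z0 : 0 < `|x| / 4 by rewrite divr_gt0// normr_gt0.
pose c := bump_mass nu * gamma (nu + 2^-1) * (`|x| / 4) `^ (- (nu - 2^-1)).
have c0 : 0 < c.
  apply: mulr_gt0; last exact: powR_gt0.
  by apply: mulr_gt0; [exact: bump_mass_gt0|rewrite gamma_euler// euler_gamma_gt0].
have := besselI_cvg nu0 x0; rewrite -/c => h.
have {}h : \int[mu]_(t in U01) (expR (x * (t - 2^-1)) * bump t `^ (nu - 1)) =
    c * besselI (nu - 2^-1) (`|x| / 2).
  (* Dividing by the nonzero constant shows that the Bessel series itself converges, so that [limn]
     in [besselI] is a genuine limit. *)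
  have : c^-1 * (c * series (besselI_term (nu - 2^-1) (`|x| / 2)) n) @[n --> \oo] -->
      c^-1 * \int[mu]_(t in U01) (expR (x * (t - 2^-1)) * bump t `^ (nu - 1)).
    by apply: cvgM; [exact: cvg_cst|exact: h].
  under eq_fun do rewrite mulKf ?gt_eqF//.
  move=> /cvg_lim => /(_ (@Rhausdorff R)); rewrite -/(besselI _ _) => ->.
  by rewrite mulVKf// gt_eqF.
have gi : mu.-integrable U01 (EFin \o (fun t => expR (x * (t - 2^-1)) * bump t `^ (nu - 1))).
  apply: (@integrable_bumpM _ _ (expR `|x|)) => //.
    apply: measurableT_comp => //.
    by apply: measurable_funM => //; apply: measurable_funB.
  move=> t /(norm_centered_le1 1); rewrite expr1 => /(ler_wpM2l (normr_ge0 x)).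
  rewrite -normrM mulr1 => xt.
  by rewrite ger0_norm ?expR_ge0// ler_expR (le_trans (ler_norm _)).
transitivity (expR (x / 2) * (c * besselI (nu - 2^-1) (`|x| / 2))).
  rewrite -h -RintegralZl//; apply: eq_Rintegral => t _.
  by rewrite mulrA -expRD; congr (expR _ * _); field.
have -> : (4 / `|x|) `^ (nu - 2^-1) = (`|x| / 4) `^ (- (nu - 2^-1)).
  by rewrite !powR_gt0E// -invf_div ?invr_gt0// lnV ?posrE// mulrN mulNr.
rewrite /c; ring.
Qed.

End bessel_series.

(** * The derivative with respect to the order *)

Section order_derivative.
Context {R : realType}.
Notation mu := (@lebesgue_measure R).
Notation U01 := (`]0%R, 1%R[%classic : set R).
Notation U0y := (`]0%R, +oo[%classic : set R).
Implicit Types (nu s t x : R).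

(** The value is the definition of [digamma], as Gamma(nu) is nonzero; the content is
    differentiability, inherited from Euler's integral, which equals [gamma] near nu. *)
Lemma is_derive_gamma nu : 0 < nu -> is_derive nu 1 gamma (gamma nu * digamma nu).
Proof.
move=> nu0.
(* A radius 2 (nu / 4) around nu keeps the exponents at least nu / 2, hence positive. *)
have d0 : 0 < nu / 4 by rewrite divr_gt0.
have [dG] : is_derive nu 1 euler_gamma
    (\int[mu]_(t in U0y) (expR (- t) * id t `^ (nu - 1) * ln (id t))).
  rewrite (_ : euler_gamma =
      fun s => \int[mu]_(t in U0y) (expR (- t) * id t `^ (s - 1))); last first.
    by apply/funext => s; rewrite euler_gammaE.
  apply: (@is_derive_powR_integral _ _ _ _ _ _ _ (nu / 4)) => //.
  - by move=> t /gt0_U0y.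
  - by move=> s /andP[ns _]; apply: integrable_gamma; lra.
have E : \forall s \near nu, euler_gamma s = gamma s.
  near=> s; rewrite gamma_euler//.
  by near: s; exact: lt_nbhsr.
move=> _; apply: DeriveDef; first exact: near_eq_derivable E dG.
have g0 : 0 < gamma nu by rewrite gamma_euler// euler_gamma_gt0.
by rewrite /digamma mulrCA divff ?mulr1 ?gt_eqF// derive1E.
Unshelve. all: by end_near. Qed.

(** Differentiating at order 0 involves negative orders, so the identities below are stated for s >
    -1/2 and used on a neighbourhood. *)
Lemma near_gt_Nhalf s : 0 <= s -> \forall r \near s, 0 < r + 2^-1.
Proof.
move=> s0; near=> r; rewrite -(subrK (2^-1) 0) ltrD2r sub0r.
by near: r; apply: lt_nbhsr; lra.
Unshelve. all: by end_near. Qed.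

Lemma measurable_expRM D x : measurable_fun D (fun t => expR (x * t)).
Proof. by apply: measurableT_comp => //; exact: measurable_funM. Qed.

Lemma integrable_exp_bump nu x : 0 < nu ->
  mu.-integrable U01 (EFin \o (fun t => expR (x * t) * bump t `^ (nu - 1))).
Proof.
move=> nu0; apply: (@integrable_bumpM _ _ (expR `|x|)) => //.
  exact: measurable_expRM.
move=> t; rewrite /= in_itv /= => /andP[t0 t1].
rewrite ger0_norm ?expR_ge0// ler_expR (le_trans (ler_norm _))// normrM ler_piMr//.
by rewrite ger0_norm ltW.
Qed.

Lemma exp_bump_ln nu x : 0 <= nu ->
  mu.-integrable U01 (EFin \o
    (fun t => expR (x * t) * bump t `^ (nu - 2^-1) * ln (bump t))) /\
  is_derive nu 1 (fun s => \int[mu]_(t in U01) (expR (x * t) * bump t `^ (s - 2^-1)))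
    (\int[mu]_(t in U01) (expR (x * t) * bump t `^ (nu - 2^-1) * ln (bump t))).
Proof.
(* The radius 2/8 keeps s + 1/2 at least 1/4, even for nu = 0. *)
move=> nu0; have d0 : (0 : R) < 8^-1 by rewrite invr_gt0.
have bi s : nu - 8^-1 *+ 2 <= s <= nu + 8^-1 *+ 2 ->
    mu.-integrable U01 (EFin \o (fun t => expR (x * t) * bump t `^ (s - 2^-1))).
  move=> /andP[ns _]; have s0 : 0 < s + 2^-1 by lra.
  have := integrable_exp_bump x s0.
  by rewrite (_ : s + 2^-1 - 1 = s - 2^-1); last by field.
split.
- apply: (@integrable_powR_ln _ _ _ _ _ _ _ 8^-1) => //; first exact: measurable_expRM.
  + exact: measurable_bump.
  + exact: bump_gt0.
- by apply: (@is_derive_powR_integral _ _ _ _ _ _ _ 8^-1) => //; exact: bump_gt0.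
Qed.

Lemma beta_bump nu : 0 < nu -> beta nu nu = bump_mass nu.
Proof.
move=> nu0; have nu2 : 0 < nu + nu by rewrite addr_gt0.
rewrite (bump_mass_gamma nu0) /beta (gamma_euler nu0) (gamma_euler nu2).
by rewrite mulr_natl mulr2n.
Qed.

Definition bessel_factor x s : R :=
  beta (s + 2^-1) (s + 2^-1) * (4 / `|x|) `^ s * expR (x / 2) * gamma (1 + s).

Lemma exp_bump_bessel s x : 0 < s + 2^-1 -> x != 0 ->
  \int[mu]_(t in U01) (expR (x * t) * bump t `^ (s - 2^-1)) =
  bessel_factor x s * besselI s (`|x| / 2).
Proof.
move=> s0 x0; have := bump_exp_integral s0 x0.
rewrite (_ : s + 2^-1 - 1 = s - 2^-1); last by field.
rewrite addrK (_ : s + 2^-1 + 2^-1 = 1 + s); last by field.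
by rewrite /bessel_factor beta_bump.
Qed.

Lemma bessel_factor_gt0 s x : 0 < s + 2^-1 -> x != 0 -> 0 < bessel_factor x s.
Proof.
move=> s0 x0; have s1 : 0 < 1 + s by lra.
rewrite /bessel_factor beta_bump// gamma_euler//.
apply: mulr_gt0; last exact: euler_gamma_gt0.
apply: mulr_gt0; last exact: expR_gt0.
apply: mulr_gt0; first exact: bump_mass_gt0.
by apply: powR_gt0; rewrite divr_gt0// normr_gt0.
Qed.

(* By the duplication formula the factor is a constant times
   [|x|^(- s) Gamma(s + 1/2)], whence the logarithmic derivative. *)
Lemma is_derive_bessel_factor s x : 0 <= s -> x != 0 ->
  is_derive s 1 (bessel_factor x) (bessel_factor x s * (digamma (s + 2^-1) - ln `|x|)).
Proof.
move=> s0 x0; have nx : 0 < `|x| by rewrite normr_gt0.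
have [c c0 hc] := @bump_mass_duplication R.
have PE (r : R) : 0 < r + 2^-1 -> c / 4 `^ (2^-1) * expR (x / 2) *
    (expR (- ln `|x| * r) * gamma (r + 2^-1)) = bessel_factor x r.
  move=> r0; have r1 : 0 < 1 + r by lra.
  have f0 : 4 `^ (2^-1) != 0 :> R by rewrite gt_eqF// powR_gt0.
  have n4 : (0 : R) < 4 by [].
  rewrite /bessel_factor beta_bump// !gamma_euler//.
  (* Splitting (4 / |x|)^r as 4^(r + 1/2) 4^(-1/2) e^(- r ln |x|) exposes the left side of the
     duplication formula at r + 1/2. *)
  rewrite [RHS](_ : _ = bump_mass (r + 2^-1) * euler_gamma (1 + r) * 4 `^ (r + 2^-1)
    / 4 `^ (2^-1) * expR (- ln `|x| * r) * expR (x / 2)); last first.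
    rewrite powRD; last by rewrite pnatr_eq0 implybT.
    rewrite (powR_gt0E _ (divr_gt0 n4 nx)) ln_div ?posrE// mulrBr expRD -powR_gt0E//.
    rewrite (_ : - (r * ln `|x|) = - ln `|x| * r); last by ring.
    by field.
  rewrite (_ : 1 + r = r + 2^-1 + 2^-1); last by field.
  by rewrite hc//; ring.
have E : \forall r \near s, c / 4 `^ (2^-1) * expR (x / 2) *
    (expR (- ln `|x| * r) * gamma (r + 2^-1)) = bessel_factor x r.
  by near=> r; apply: PE; near: r; exact: near_gt_Nhalf.
apply: near_eq_is_derive E _.
have sh : 0 < s + 2^-1 by lra.
have d1 := is_derive_expRM (- ln `|x|) s.
have d2 : is_derive s 1 (fun r => gamma (r + 2^-1))
    (gamma (s + 2^-1) * digamma (s + 2^-1)).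
  have dg := is_derive_gamma sh.
  have dh : is_derive s 1 (fun r : R => r + 2^-1) 1.
    by apply: is_derive_eq; rewrite scaler0 addr0.
  by have := @is_derive1_comp R gamma (fun r : R => r + 2^-1) s _ _ dg dh; rewrite mulr1.
apply: is_derive_eq; rewrite -(PE _ sh) /GRing.scale /=; ring.
Unshelve. all: by end_near. Qed.

(** Near s the Bessel function is the quotient F / P, so the quotient rule both proves it
    differentiable in its order and, solved for F', gives the formula; no termwise differentiation
    of the series is involved. *)
Lemma is_derive_besselI s x (dF : R) : 0 <= s -> x != 0 ->
  is_derive s 1 (fun r => \int[mu]_(t in U01) (expR (x * t) * bump t `^ (r - 2^-1))) dF ->
  dF = bessel_factor x s * (besselI s (`|x| / 2) * (digamma (s + 2^-1) - ln `|x|) +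
     dbesselI_order s (`|x| / 2)).
Proof.
move=> s0 x0 hF; have sh : 0 < s + 2^-1 by lra.
have P0 := lt0r_neq0 (bessel_factor_gt0 sh x0).
have dV := is_deriveV P0 (is_derive_bessel_factor s0 x0).
have dI := is_deriveM hF dV.
have E : \forall r \near s,
    ((fun r => \int[mu]_(t in U01) (expR (x * t) * bump t `^ (r - 2^-1))) *
     (fun r => (bessel_factor x r)^-1)) r = besselI r (`|x| / 2).
  near=> r; have r0 : 0 < r + 2^-1 by near: r; exact: near_gt_Nhalf.
  by rewrite fctE exp_bump_bessel// mulrC mulKf// gt_eqF// bessel_factor_gt0.
have {}dI := near_eq_is_derive E dI.
have := @derive_val _ _ _ _ _ _ _ dI; rewrite -derive1E -/(dbesselI_order s (`|x| / 2)) => ->.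
rewrite exp_bump_bessel// /GRing.scale /=.
move: (bessel_factor x s) (besselI _ _) P0 => P I P0.
by field.
Unshelve. all: by end_near. Qed.

End order_derivative.

Unset Implicit Arguments.

Theorem theorem26 (R : realType) (mu x : R) (hmu : 0 <= mu) (hx : x != 0) :
  (\int[@lebesgue_measure R]_(t in `]0%R, 1%R[)
     (expR (x * t) * (t * (1 - t)) `^ (mu - 2^-1) * ln (t * (1 - t)))%:E)%E =
  (beta (mu + 2^-1) (mu + 2^-1) * (4 / `|x|) `^ mu * expR (x / 2) *
     gamma (1 + mu) *
     (besselI mu (`|x| / 2) * (digamma (mu + 2^-1) - ln `|x|) +
      dbesselI_order mu (`|x| / 2)))%:E.
Proof.
have [fi dF] := exp_bump_ln x hmu.
rewrite -[RHS]/((bessel_factor x mu * _)%:E) -(is_derive_besselI hmu hx dF).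
(* The integral of the statement is extended-real; integrability makes it finite, so it agrees with
   its [fine] part. *)
by rewrite /Rintegral fineK//; exact: integrable_fin_num.
Qed.
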